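(* Let $T$ be an estimated partitioned tensor. For all $\rho\in[2,3]$, \[V^{\mathrm{pr}}_\rho(T)=\max_{P\in\mathrm{dist}(T)}V^{\mathrm{pr}}_{\rho,P}(T).\]
   Context: Fix a field $\mathbb{F}$. A tensor over finite variable sets $X,Y,Z$ is a trilinear form $\sum T_{xyz}xyz$. Two tensors are equivalent if they differ by bijective renamings of $x$-, $y$-, $z$-variables separately. $\langle n,m,p\rangle=\sum_{i\le n,j\le m,k\le p}x_{ij}y_{jk}z_{ki}$; a tensor equivalent to it is a matrix multiplication tensor with volume $\mathrm{Vol}=nmp$. Tensor product $T\otimes T'$: tensor over $X\times X',Y\times Y',Z\times Z'$ with coefficients $T_{xyz}T'_{x'y'z'}$. Rotation: $T^{\mathrm{rot}}=\sum T_{xyz}\,yzx$ regarded as a tensor over $Y,Z,X$; $T^{\mathrm{rot}2}=(T^{\mathrm{rot}})^{\mathrm{rot}}$. Partitioned tensors: with $X=\bigsqcup_{i\in I}X_i$, $Y=\bigsqcup_{j\in J}Y_j$, $Z=\bigsqcup_{k\in K}Z_k$, a partitioned tensor is $T=\sum_sT_s$ with each constituent $T_s$ a nonzero tensor over $X_i,Y_j,Z_k$ for an annotation $s=(i,j,k)$, distinct constituents having distinct annotations; $\operatorname{supp}(T)$ is the set of annotations. Products of partitioned tensors are partitioned by products of parts, with constituents $T_s\otimes T'_{s'}$; annotations of $T^{\otimes N}$ are index triples in $I^N\times J^N\times K^N$; a set of index triples is strongly disjoint if no two share an $x$-index, a $y$-index, or a $z$-index. $T^{\mathrm{rot}}$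 is partitioned identically with rotated support. A partitioned restriction is obtained by zeroing all variables in some of the parts $X_i$, $Y_j$, $Z_k$; its constituents are the surviving $T_s$. An estimated partitioned tensor is a partitioned tensor with functions $\mathrm{Val}_\rho(T_s)\ge0$ ($\rho\in[2,3]$, $s\in\operatorname{supp}(T)$), equal to $\mathrm{Vol}(T_s)^{\rho/3}$ when $T_s$ is a matrix multiplication tensor; rotations keep values, and the value of a product of constituents is the product of values. $V^{\mathrm{pr}}_{\rho,3N}(T)$ is the maximum of $\sum_{s\in\operatorname{supp}(T')}\mathrm{Val}_\rho(T'_s)$ over partitioned restrictions $T'$ of $(T\otimes T^{\mathrm{rot}}\otimes T^{\mathrm{rot}2})^{\otimes N}$ with strongly disjoint support; $V^{\mathrm{pr}}_\rho(T)=\lim_N V^{\mathrm{pr}}_{\rho,3N}(T)^{1/3N}$. $\mathrm{dist}(T)$ is the set of probability distributions on $\operatorname{supp}(T)$. For $P\in\mathrm{dist}(T)$ and $N\ge1$, let $r_N(P)$ be a fixed (canonical) vector of nonnegative integers indexed by $\operatorname{supp}(T)$, summing to $N$, obtained by rounding $N\cdot P$. For a partitioned restriction $T'$ of $(T\otimes T^{\mathrm{rot}}\otimes T^{\mathrm{rot}2})^{\otimes N}$, $\operatorname{supp}_P(T')$ is the set of annotations in $\operatorname{supp}(T')$ in which, for each $s\in\operatorname{supp}(T)$, each of the factors $T_s$, $T_s^{\mathrm{rot}}$, $T_s^{\mathrm{rot}2}$ (constituents of $T,T^{\mathrm{rot}},T^{\mathrm{rot}2}$ respectively) appears exactly $r_N(P)(s)$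 times. $V^{\mathrm{pr}}_{\rho,P,3N}(T)$ is the maximum of $\sum_{s\in\operatorname{supp}_P(T')}\mathrm{Val}_\rho(T'_s)$ over partitioned restrictions $T'$ of $(T\otimes T^{\mathrm{rot}}\otimes T^{\mathrm{rot}2})^{\otimes N}$ with strongly disjoint support, and $V^{\mathrm{pr}}_{\rho,P}(T)=\lim_{N\to\infty}V^{\mathrm{pr}}_{\rho,P,3N}(T)^{1/3N}$ (this limit exists). *)

(* Defs.v *)
From mathcomp Require Import all_boot all_order all_algebra.
From mathcomp Require Import all_classical all_reals all_analysis.

Set Implicit Arguments.
Unset Strict Implicit.
Unset Printing Implicit Defensive.

Import Order.TTheory GRing.Theory Num.Theory.
Import numFieldNormedType.Exports.

Local Open Scope classical_set_scope.
Local Open Scope ring_scope.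

(** * Tensors *)

(* The trilinear form \sum T_xyz xyz, given by its coefficients. *)
Definition tensor (F : fieldType) (X Y Z : finType) : Type := X -> Y -> Z -> F.

Definition nonzero_tensor (F : fieldType) (X Y Z : finType)
    (T : tensor F X Y Z) : bool :=
  [exists x, exists y, exists z, T x y z != 0].

Definition tensor_equiv (F : fieldType) (X Y Z X' Y' Z' : finType)
    (T : tensor F X Y Z) (T' : tensor F X' Y' Z') : Prop :=
  exists (f : X -> X') (g : Y -> Y') (h : Z -> Z'),
    [/\ bijective f, bijective g, bijective h &
        forall x y z, T x y z = T' (f x) (g y) (h z)].

(* <n, m, p> = \sum_(i, j, k) x_ij y_jk z_ki *)
Definition mm_tensor (F : fieldType) (n m p : nat) :
    tensor F ('I_n * 'I_m)%type ('I_m * 'I_p)%type ('I_p * 'I_n)%type :=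
  fun x y z => [&& x.2 == y.1, y.2 == z.1 & z.2 == x.1]%:R.

Arguments mm_tensor F n m p _ _ _ : clear implicits.

(** * Partitioned tensors *)

(* The partition X = \bigsqcup_(i in I) X_i is given by the map [partX] sending
   a variable to the index of its part, and similarly for Y and Z. *)
Record ptensor (F : fieldType) := PTensor {
  varX : finType; varY : finType; varZ : finType;
  idxX : finType; idxY : finType; idxZ : finType;
  partX : varX -> idxX; partY : varY -> idxY; partZ : varZ -> idxZ;
  coef : tensor F varX varY varZ }.

Definition annot (F : fieldType) (T : ptensor F) : finType :=
  (idxX T * idxY T * idxZ T)%type.

Definition annX (F : fieldType) (T : ptensor F) (s : annot T) : idxX T := s.1.1.
Definition annY (F : fieldType) (T : ptensor F) (s : annot T) : idxY T := s.1.2.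
Definition annZ (F : fieldType) (T : ptensor F) (s : annot T) : idxZ T := s.2.

(* T_s, a tensor over the variable sets X_i, Y_j, Z_k where s = (i, j, k); it is
   a constituent of T in the strict sense only when it is nonzero. *)
Definition constituent (F : fieldType) (T : ptensor F) (s : annot T) :
    tensor F {x : varX T | partX x == annX s}
             {y : varY T | partY y == annY s}
             {z : varZ T | partZ z == annZ s} :=
  fun x y z => coef (val x) (val y) (val z).

Arguments constituent {F T} s _ _ _.

Definition supp (F : fieldType) (T : ptensor F) : {set annot T} :=
  [set s | nonzero_tensor (constituent s)]%SET.

(* T^rot = \sum T_xyz yzx, over Y, Z, X *)
Definition ptensor_rot (F : fieldType) (T : ptensor F) : ptensor F :=
  {| varX := varY T; varY := varZ T; varZ := varX T;
     idxX := idxY T; idxY := idxZ T; idxZ := idxX T;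
     partX := @partY F T; partY := @partZ F T; partZ := @partX F T;
     coef := fun y z x => coef x y z |}.

Definition ptensor_mul (F : fieldType) (T T' : ptensor F) : ptensor F :=
  {| varX := (varX T * varX T')%type;
     varY := (varY T * varY T')%type;
     varZ := (varZ T * varZ T')%type;
     idxX := (idxX T * idxX T')%type;
     idxY := (idxY T * idxY T')%type;
     idxZ := (idxZ T * idxZ T')%type;
     partX := fun x => (partX x.1, partX x.2);
     partY := fun y => (partY y.1, partY y.2);
     partZ := fun z => (partZ z.1, partZ z.2);
     coef := fun x y z => coef x.1 y.1 z.1 * coef x.2 y.2 z.2 |}.

Definition ptensor_exp (F : fieldType) (T : ptensor F) (N : nat) : ptensor F :=
  {| varX := {ffun 'I_N -> varX T};
     varY := {ffun 'I_N -> varY T};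
     varZ := {ffun 'I_N -> varZ T};
     idxX := {ffun 'I_N -> idxX T};
     idxY := {ffun 'I_N -> idxY T};
     idxZ := {ffun 'I_N -> idxZ T};
     partX := fun x => [ffun n => partX (x n)];
     partY := fun y => [ffun n => partY (y n)];
     partZ := fun z => [ffun n => partZ (z n)];
     coef := fun x y z => \prod_(n < N) coef (x n) (y n) (z n) |}.

(* A, B, C are the sets of indices of the parts that are kept; all variables in
   the other parts are set to zero. *)
Definition ptensor_restr (F : fieldType) (T : ptensor F)
    (A : {set idxX T}) (B : {set idxY T}) (C : {set idxZ T}) : ptensor F :=
  {| varX := varX T; varY := varY T; varZ := varZ T;
     idxX := idxX T; idxY := idxY T; idxZ := idxZ T;
     partX := @partX F T; partY := @partY F T; partZ := @partZ F T;
     coef := fun x y z =>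
       if [&& partX x \in A, partY y \in B & partZ z \in C]
       then coef x y z else 0 |}.

Definition strongly_disjoint (F : fieldType) (T : ptensor F)
    (S : {set annot T}) : bool :=
  [forall s in S, forall s' in S, (s != s') ==>
     [&& annX s != annX s', annY s != annY s' & annZ s != annZ s']].

(* The annotation s of T, seen as the annotation of T^rot of the constituent
   (T_s)^rot. *)
Definition annot_rot (F : fieldType) (T : ptensor F) (s : annot T) :
    annot (ptensor_rot T) := (annY s, annZ s, annX s).

(* The annotations of the factors of a constituent of a product or a power. *)
Definition annot_fst (F : fieldType) (T T' : ptensor F)
    (s : annot (ptensor_mul T T')) : annot T :=
  ((annX s).1, (annY s).1, (annZ s).1).

Definition annot_snd (F : fieldType) (T T' : ptensor F)
    (s : annot (ptensor_mul T T')) : annot T' :=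
  ((annX s).2, (annY s).2, (annZ s).2).

Definition annot_nth (F : fieldType) (T : ptensor F) (N : nat)
    (s : annot (ptensor_exp T N)) (n : 'I_N) : annot T :=
  (annX s n, annY s n, annZ s n).

(** * Estimated partitioned tensors *)

(* [Val rho s] stands for Val_rho(T_s); it is only meaningful for
   2 <= rho <= 3 and s in supp T. *)
Record vtensor (R : realType) (F : fieldType) := VTensor {
  vtensor_pt :> ptensor F;
  Val : R -> annot vtensor_pt -> R }.

(* If T_s is equivalent to <n, m, p>, then n m = #|X_i|, m p = #|Y_j| and
   p n = #|Z_k|, so that its volume n m p does not depend on the choice of
   n, m, p.

   This is a predicate on [vtensor] because it is required of the given tensor
   only: the values of products are products of values by definition, even if a
   product of constituents is a matrix multiplication tensor although its
   factors are not. *)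
Definition estimated (R : realType) (F : fieldType) (T : vtensor R F) : Prop :=
  forall (rho : R) (s : annot T), 2 <= rho <= 3 -> s \in supp T ->
    0 <= Val rho s /\
    forall n m p : nat, tensor_equiv (constituent s) (mm_tensor F n m p) ->
      Val rho s = (n * m * p)%:R `^ (rho / 3).

Definition vtensor_rot (R : realType) (F : fieldType) (T : vtensor R F) :
    vtensor R F :=
  @VTensor R F (ptensor_rot T)
    (fun rho s => Val rho ((annZ s, annX s, annY s) : annot T)).

Definition vtensor_mul (R : realType) (F : fieldType) (T T' : vtensor R F) :
    vtensor R F :=
  @VTensor R F (ptensor_mul T T')
    (fun rho s => Val rho (annot_fst s) * Val rho (annot_snd s)).

Definition vtensor_exp (R : realType) (F : fieldType) (T : vtensor R F)
    (N : nat) : vtensor R F :=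
  @VTensor R F (ptensor_exp T N)
    (fun rho s => \prod_(n < N) Val rho (annot_nth s n)).

Definition vtensor_restr (R : realType) (F : fieldType) (T : vtensor R F)
    (A : {set idxX T}) (B : {set idxY T}) (C : {set idxZ T}) : vtensor R F :=
  @VTensor R F (ptensor_restr A B C) (fun rho s => Val rho (s : annot T)).

Definition rot3 (R : realType) (F : fieldType) (T : vtensor R F) :
    vtensor R F :=
  vtensor_mul (vtensor_mul T (vtensor_rot T)) (vtensor_rot (vtensor_rot T)).

(** * Values *)

(* Maximum, over the partitioned restrictions T' of W with strongly disjoint
   support, of the sum of the values of the constituents of T' whose annotation
   lies in S.  The restriction with A = B = C = set0 has empty support, and for
   nonnegative values all the sums are nonnegative, so that the default element
   0 does not affect the maximum. *)
Definition max_restr (R : realType) (F : fieldType) (W : vtensor R F) (rho : R)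
    (S : {set annot W}) : R :=
  \big[Order.max/0]_(D : {set idxX W} * {set idxY W} * {set idxZ W} |
      strongly_disjoint (supp (vtensor_restr D.1.1 D.1.2 D.2)))
    \sum_(s in supp (vtensor_restr D.1.1 D.1.2 D.2) | (s : annot W) \in S)
      Val rho s.

(* V^pr_(rho, 3N)(T) *)
Definition VprN (R : realType) (F : fieldType) (T : vtensor R F) (rho : R)
    (N : nat) : R :=
  max_restr (W := vtensor_exp (rot3 T) N) rho [set: _]%SET.

Definition Vpr_seq (R : realType) (F : fieldType) (T : vtensor R F) (rho : R) :
    R^nat :=
  fun N => VprN T rho N `^ (3 * N)%:R^-1.

Definition Vpr (R : realType) (F : fieldType) (T : vtensor R F) (rho : R) : R :=
  limn (Vpr_seq T rho).

(* Probability distributions on supp T, extended by 0 to all annotations. *)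
Definition dist (R : realType) (F : fieldType) (T : vtensor R F) :
    set {ffun annot T -> R} :=
  [set P | [/\ forall s, 0 <= P s,
               forall s, s \notin supp T -> P s = 0 &
               \sum_(s in supp T) P s = 1]].

Arguments dist {R F} T _.

(* [r N P] is r_N(P): N * P rounded coordinatewise, up or down, in such a way
   that the sum is N. *)
Definition rounding (R : realType) (F : fieldType) (T : vtensor R F)
    (r : nat -> {ffun annot T -> R} -> annot T -> nat) : Prop :=
  forall (N : nat) (P : {ffun annot T -> R}), (0 < N)%N -> dist T P ->
    (\sum_(s in supp T) r N P s)%N = N /\
    forall s, s \in supp T ->
      Num.floor (N%:R * P s) <= (r N P s)%:Z <= Num.ceil (N%:R * P s).

(* The annotations of (T (x) T^rot (x) T^rot2)^(x) N in which each of T_s,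
   T_s^rot, T_s^rot2 appears exactly [c s] times, for all s in supp T. *)
Definition annot_type (R : realType) (F : fieldType) (T : vtensor R F)
    (N : nat) (c : annot T -> nat) : {set annot (vtensor_exp (rot3 T) N)} :=
  [set t : annot (vtensor_exp (rot3 T) N) | [forall s in supp T,
     [&& #|[set n | annot_fst (annot_fst (annot_nth t n)) == s]%SET| == c s,
         #|[set n | annot_snd (annot_fst (annot_nth t n))
                    == annot_rot s]%SET| == c s &
         #|[set n | annot_snd (annot_nth t n)
                    == annot_rot (annot_rot s)]%SET| == c s]]]%SET.

(* V^pr_(rho, P, 3N)(T); [r] is the rounding rule. *)
Definition VprPN (R : realType) (F : fieldType) (T : vtensor R F)
    (r : nat -> {ffun annot T -> R} -> annot T -> nat) (rho : R)
    (P : {ffun annot T -> R}) (N : nat) : R :=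
  max_restr (W := vtensor_exp (rot3 T) N) rho (annot_type N (r N P)).

Definition VprP_seq (R : realType) (F : fieldType) (T : vtensor R F)
    (r : nat -> {ffun annot T -> R} -> annot T -> nat) (rho : R)
    (P : {ffun annot T -> R}) : R^nat :=
  fun N => VprPN r rho P N `^ (3 * N)%:R^-1.

Definition VprP (R : realType) (F : fieldType) (T : vtensor R F)
    (r : nat -> {ffun annot T -> R} -> annot T -> nat) (rho : R)
    (P : {ffun annot T -> R}) : R :=
  limn (VprP_seq r rho P).

Definition is_maximum (R : realType) (m : R) (A : set R) : Prop :=
  A m /\ ubound A m.

(* Main.v *)
Require Import Defs.
From mathcomp Require Import all_boot all_order all_algebra.
From mathcomp Require Import all_classical all_reals all_analysis.
From mathcomp Require Import zify ring lra.

Import Order.TTheory GRing.Theory Num.Theory.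
Import numFieldNormedType.Exports.

Set Implicit Arguments.
Unset Strict Implicit.
Unset Printing Implicit Defensive.

(** The constituents of (T (x) T^rot (x) T^rot2)^(x) N are words of length N
    over the alphabet supp T x supp T^rot x supp T^rot2, and their joint types
    (how often each letter occurs) are polynomially many in N.  So some joint
    type k_N carries the N-th value up to a subexponential factor.  Multiplying
    a restriction with its two rotations makes the three marginals of the type
    equal, at the cost of tripling N.

    Let Q be a cluster point of k_N / N and P the average of its marginals.  The
    letters that occur in k_N but not in Q have density o(1); deleting them
    from the words costs a binomial coefficient 'C(N, o(N)), which is
    subexponential, and leaves a type whose averaged marginal c is supported in
    supp P and close to P.  Then floor(M / N) copies of c, up to a factor close
    to 1, fit below r_M(P), and supermultiplicativity bounds the value at r_M(P)
    from below.  The same comparison, applied to c = r_N(P) itself, is an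
    approximate Fekete lemma giving the convergence for each P. *)

Local Open Scope ring_scope.

(** * Words and their strongly disjoint restrictions *)

Section Words.
Variables (R : realFieldType) (I J K : finType).

(** A triple of functions rather than a function into triples: this is definitionally the type of
    annotations of an [N]-th tensor power. *)
Definition word N : finType :=
  ({ffun 'I_N -> I} * {ffun 'I_N -> J} * {ffun 'I_N -> K})%type.

Definition letter N (w : word N) (n : 'I_N) : I * J * K :=
  (w.1.1 n, w.1.2 n, w.2 n).

Lemma wordP N (w w' : word N) : letter w =1 letter w' -> w = w'.
Proof.
case: w w' => [[x y] z] [[x' y'] z'] eq_w.
by congr (_, _, _); apply/ffunP => n; case: (eq_w n).
Qed.

Definition mkword N (l : 'I_N -> I * J * K) : word N :=
  ([ffun n => (l n).1.1], [ffun n => (l n).1.2], [ffun n => (l n).2]).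

Lemma letter_mkword N (l : 'I_N -> I * J * K) : letter (mkword l) =1 l.
Proof. by move=> n; rewrite /letter !ffunE; case: (l n) => [[]]. Qed.

Definition restriction N : finType :=
  ({set {ffun 'I_N -> I}} * {set {ffun 'I_N -> J}} *
   {set {ffun 'I_N -> K}})%type.

Definition sdisj N (U : {set word N}) : bool :=
  [forall s in U, forall s' in U, (s != s') ==>
     [&& s.1.1 != s'.1.1, s.1.2 != s'.1.2 & s.2 != s'.2]].

Lemma sdisjP N (U : {set word N}) :
  reflect (forall s s', s \in U -> s' \in U ->
             [\/ s.1.1 = s'.1.1, s.1.2 = s'.1.2 | s.2 = s'.2] -> s = s')
          (sdisj U).
Proof.
apply: (iffP forall_inP) => [dU s s' Us Us' e | dU s Us].
  apply/eqP; apply: contraT => ne.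
  have /forall_inP/(_ s' Us')/implyP/(_ ne)/and3P[] := dU s Us.
  by case: e => ->; rewrite eqxx.
apply/forall_inP => s' Us'; apply/implyP => ne.
by apply/and3P; split; apply: contraNneq ne => e; apply/eqP/dU;
  rewrite ?e //; [constructor 1 | constructor 2 | constructor 3].
Qed.

Variables (S : {set I * J * K}) (v : I * J * K -> R).
Hypothesis v_ge0 : forall a, a \in S -> 0 <= v a.

(** The support of the restriction: [S] stands for the support of the base tensor, and a constituent
    of the power is nonzero exactly when all its factors are. *)
Definition live N (D : restriction N) : {set word N} :=
  [set w | [forall n, letter w n \in S] &&
           [&& w.1.1 \in D.1.1, w.1.2 \in D.1.2 & w.2 \in D.2]].

Definition wt N (w : word N) : R := \prod_(n < N) v (letter w n).

(** Abstract form of [max_restr]. The empty restriction is admissible and all sums are nonnegative,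
    so the default 0 does not alter the maximum. *)
Definition value N (U : {set word N}) : R :=
  \big[Order.max/0]_(D : restriction N | sdisj (live D))
    \sum_(w in live D | w \in U) wt w.

Lemma live_letter N (D : restriction N) w n : w \in live D -> letter w n \in S.
Proof. by rewrite inE => /andP[/forallP]. Qed.

Lemma wt_ge0 N (D : restriction N) w : w \in live D -> 0 <= wt w.
Proof. by move=> /live_letter Dw; apply: prodr_ge0 => n _; apply/v_ge0/Dw. Qed.

Lemma sum_ge0 N (D : restriction N) (P : pred (word N)) :
  0 <= \sum_(w in live D | P w) wt w.
Proof. by apply: sumr_ge0 => w /andP[/wt_ge0]. Qed.

Lemma value_ub N (D : restriction N) (U : {set word N}) : sdisj (live D) ->
  \sum_(w in live D | w \in U) wt w <= value U.
Proof.
by move=> dD; apply: (le_bigmax_cond _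
  (fun D : restriction N => \sum_(w in live D | w \in U) wt w)).
Qed.

Lemma value_attained N (U : {set word N}) :
  exists2 D : restriction N, sdisj (live D) &
    value U = \sum_(w in live D | w \in U) wt w.
Proof.
have d0 : sdisj (live ((finset.set0, finset.set0, finset.set0) : restriction N)).
  by apply/sdisjP => s s'; rewrite inE /= inE andbF.
have e := @bigmax_eq_arg _ _ _ 0 (finset.set0, finset.set0, finset.set0)
  (fun D : restriction N => sdisj (live D))
  (fun D : restriction N => \sum_(w in live D | w \in U) wt w) d0
  (fun D _ => sum_ge0 D (mem U)).
by move: e; case: arg_maxP => // D dD _ e; exists D.
Qed.

Lemma value_ge0 N (U : {set word N}) : 0 <= value U.
Proof. by have [D _ ->] := value_attained U; apply: sum_ge0. Qed.

Lemma le_value N (U U' : {set word N}) :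
  (forall w, (forall n, letter w n \in S) -> w \in U -> w \in U') ->
  value U <= value U'.
Proof.
move=> sUU'; have [D dD ->] := value_attained U.
apply: le_trans (value_ub U' dD).
rewrite !big_mkcondr /=; apply: ler_sum => w Dw.
case: ifP => [/sUU'->//|_]; first by move=> n; apply: live_letter Dw.
by case: ifP => // _; apply: wt_ge0 Dw.
Qed.

(** An optimal restriction for [U] is a candidate for every class [V a], and the classes cover [U]
    through [f]. *)
Lemma value_le_sum (A : finType) N (U : {set word N})
    (V : A -> {set word N}) (f : word N -> A) :
  (forall w, w \in U -> w \in V (f w)) -> value U <= \sum_a value (V a).
Proof.
move=> sUV; have [D dD ->] := value_attained U.
rewrite (partition_big f xpredT) //=; apply: ler_sum => a _.
apply: le_trans (value_ub (V a) dD).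
rewrite !big_mkcondr /= [leRHS]big_mkcond [leLHS]big_mkcond /=.
apply: ler_sum => w _; case: ifP => // Dw.
case: (boolP (w \in U)) => [/sUV Vw|_]; last first.
  by case: ifP => // _; apply: wt_ge0 Dw.
case: eqP => [<-|_]; first by rewrite Vw.
by case: ifP => // _; apply: wt_ge0 Dw.
Qed.

(** Keeping only the three parts that index [w] leaves [w] as the single live word. *)
Lemma value_ge_wt N (U : {set word N}) w :
  (forall n, letter w n \in S) -> w \in U -> wt w <= value U.
Proof.
move=> Sw Uw; pose D : restriction N := ([set w.1.1], [set w.1.2], [set w.2]).
have liveD s : (s \in live D) = (s == w).
  rewrite inE /= !inE; apply/andP/eqP => [[_ /and3P[]]|->]; last first.
    by split; [apply/forallP | rewrite !eqxx].
  by case: s w {D Sw Uw} => [[? ?] ?] [[? ?] ?] /=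
    => /eqP-> /eqP-> /eqP->.
have dD : sdisj (live D).
  by apply/sdisjP => s s'; rewrite !liveD => /eqP-> /eqP->.
apply: le_trans (value_ub U dD).
by rewrite (bigD1 w) ?liveD ?eqxx //= lerDl; apply: sumr_ge0 => s /andP[/andP[/wt_ge0]].
Qed.

(** * Concatenation of words and supermultiplicativity *)

Definition lword N1 N2 (w : word (N1 + N2)) : word N1 :=
  mkword (fun n => letter w (lshift N2 n)).
Definition rword N1 N2 (w : word (N1 + N2)) : word N2 :=
  mkword (fun n => letter w (rshift N1 n)).
Definition catword N1 N2 (w1 : word N1) (w2 : word N2) : word (N1 + N2) :=
  mkword (fun n => match fintype.split n with inl n1 => letter w1 n1
                                    | inr n2 => letter w2 n2 end).

Lemma letter_catl N1 N2 (w1 : word N1) (w2 : word N2) n :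
  letter (catword w1 w2) (lshift N2 n) = letter w1 n.
Proof. by rewrite letter_mkword (unsplitK (inl n : 'I_N1 + 'I_N2)). Qed.

Lemma letter_catr N1 N2 (w1 : word N1) (w2 : word N2) n :
  letter (catword w1 w2) (rshift N1 n) = letter w2 n.
Proof. by rewrite letter_mkword (unsplitK (inr n : 'I_N1 + 'I_N2)). Qed.

Lemma lword_cat N1 N2 (w1 : word N1) (w2 : word N2) : lword (catword w1 w2) = w1.
Proof. by apply: wordP => n; rewrite letter_mkword letter_catl. Qed.

Lemma rword_cat N1 N2 (w1 : word N1) (w2 : word N2) : rword (catword w1 w2) = w2.
Proof. by apply: wordP => n; rewrite letter_mkword letter_catr. Qed.

Lemma cat_lrword N1 N2 (w : word (N1 + N2)) : catword (lword w) (rword w) = w.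
Proof.
apply: wordP => n; rewrite letter_mkword -[in RHS](splitK n).
by case: (fintype.split n) => k; rewrite letter_mkword.
Qed.

Lemma wt_cat N1 N2 (w1 : word N1) (w2 : word N2) :
  wt (catword w1 w2) = wt w1 * wt w2.
Proof.
rewrite /wt big_split_ord /=; congr (_ * _); apply: eq_bigr => n _.
  by rewrite letter_catl.
by rewrite letter_catr.
Qed.

(** The product of two restrictions keeps the words whose two halves survive. If two such words
    share a coordinate, so do both pairs of halves, hence the product is again strongly disjoint. *)
Lemma value_mul N1 N2 (U1 : {set word N1}) (U2 : {set word N2})
    (U : {set word (N1 + N2)}) :
  (forall w1 w2, w1 \in U1 -> w2 \in U2 -> catword w1 w2 \in U) ->
  value U1 * value U2 <= value U.
Proof.
move=> sU; have [D1 /sdisjP dD1 ->] := value_attained U1.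
have [D2 /sdisjP dD2 ->] := value_attained U2.
pose fl (A : Type) (f : {ffun 'I_(N1 + N2) -> A}) := [ffun n => f (lshift N2 n)].
pose fr (A : Type) (f : {ffun 'I_(N1 + N2) -> A}) := [ffun n => f (rshift N1 n)].
pose D : restriction (N1 + N2) :=
  ([set f | (fl _ f \in D1.1.1) && (fr _ f \in D2.1.1)],
   [set f | (fl _ f \in D1.1.2) && (fr _ f \in D2.1.2)],
   [set f | (fl _ f \in D1.2) && (fr _ f \in D2.2)]).
have lE w : [/\ (lword w).1.1 = fl _ w.1.1, (lword w).1.2 = fl _ w.1.2
              & (lword w).2 = fl _ w.2].
  by split; apply/ffunP => n; rewrite !ffunE.
have rE w : [/\ (rword w).1.1 = fr _ w.1.1, (rword w).1.2 = fr _ w.1.2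
              & (rword w).2 = fr _ w.2].
  by split; apply/ffunP => n; rewrite !ffunE.
have liveD w : (w \in live D) = (lword w \in live D1) && (rword w \in live D2).
  rewrite [LHS]inE /= !inE.
  have [-> -> ->] := lE w; have [-> -> ->] := rE w.
  have -> : [forall n, letter w n \in S] =
    [forall n, letter (lword w) n \in S] && [forall n, letter (rword w) n \in S].
    apply/forallP/andP => [Sw|[/forallP Sl /forallP Sr] n].
      by split; apply/forallP => n; rewrite letter_mkword.
    rewrite -(splitK n); case: (fintype.split n) => k /=.
      by have := Sl k; rewrite letter_mkword.
    by have := Sr k; rewrite letter_mkword.
  by rewrite -!andbA; do !bool_congr.
have dD : sdisj (live D).
  apply/sdisjP => s s'; rewrite !liveD => /andP[sl sr] /andP[sl' sr'] e.
  rewrite -(cat_lrword s) -(cat_lrword s'); congr catword.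
    apply: dD1 => //; have [-> -> ->] := lE s; have [-> -> ->] := lE s'.
    by case: e => ->; [constructor 1 | constructor 2 | constructor 3].
  apply: dD2 => //; have [-> -> ->] := rE s; have [-> -> ->] := rE s'.
  by case: e => ->; [constructor 1 | constructor 2 | constructor 3].
apply: le_trans (value_ub U dD).
rewrite big_distrlr /= pair_big /=.
rewrite [leRHS](reindex (fun p : word N1 * word N2 => catword p.1 p.2)) /=; last first.
  exists (fun w => (lword w, rword w)) => [[w1 w2] _|w _] /=.
    by rewrite lword_cat rword_cat.
  by rewrite cat_lrword.
rewrite [leLHS]big_mkcond [leRHS]big_mkcond; apply: ler_sum => -[w1 w2] _ /=.
rewrite liveD lword_cat rword_cat wt_cat.
case: (boolP (w1 \in live D1)) => //= Dw1; case: (boolP (w2 \in live D2)) => //=;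
  rewrite ?andbF // => Dw2.
have ge0 : 0 <= wt w1 * wt w2 by rewrite mulr_ge0 // (wt_ge0 Dw1, wt_ge0 Dw2).
case: ifP => [/andP[Uw1 Uw2]|_]; first by rewrite sU.
by case: ifP.
Qed.

(** * Deletion of a letter *)

Definition delword N (i : 'I_N.+1) (w : word N.+1) : word N :=
  mkword (fun n => letter w (lift i n)).
Definition insword N (i : 'I_N.+1) (a : I * J * K) (w : word N) : word N.+1 :=
  mkword (fun n => if unlift i n is Some k then letter w k else a).

Lemma letter_ins_eq N (i : 'I_N.+1) a (w : word N) : letter (insword i a w) i = a.
Proof. by rewrite letter_mkword unlift_none. Qed.

Lemma letter_ins_lift N (i : 'I_N.+1) a (w : word N) k :
  letter (insword i a w) (lift i k) = letter w k.
Proof. by rewrite letter_mkword liftK. Qed.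

Lemma insK N (i : 'I_N.+1) a (w : word N) : delword i (insword i a w) = w.
Proof. by apply: wordP => n; rewrite letter_mkword letter_ins_lift. Qed.

Lemma delK N (i : 'I_N.+1) (w : word N.+1) :
  insword i (letter w i) (delword i w) = w.
Proof.
apply: wordP => n; rewrite letter_mkword; case: unliftP => [k|] -> //.
by rewrite letter_mkword.
Qed.

(** Slice the restriction at position [i]: keep the shorter index words whose extension by the
    coordinates of [a] is kept by [D]. Inserting [a] preserves shared coordinates, so strong
    disjointness is inherited, and each weight loses exactly the factor [v a]. *)
Lemma value_del N (i : 'I_N.+1) a (U : {set word N.+1}) (U' : {set word N}) D :
  a \in S -> sdisj (live D) ->
  (forall w, w \in U -> letter w i = a -> delword i w \in U') ->
  \sum_(w in live D | (w \in U) && (letter w i == a)) wt w <= v a * value U'.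
Proof.
move=> Sa /sdisjP dD sU.
pose ins (A : Type) (b : A) (f : {ffun 'I_N -> A}) : {ffun 'I_N.+1 -> A} :=
  [ffun n => if unlift i n is Some k then f k else b].
have insE w : [/\ (insword i a w).1.1 = ins _ a.1.1 w.1.1,
                  (insword i a w).1.2 = ins _ a.1.2 w.1.2
                & (insword i a w).2 = ins _ a.2 w.2].
  by split; apply/ffunP => n; rewrite !ffunE; case: unliftP.
pose D' : restriction N :=
  ([set f | ins _ a.1.1 f \in D.1.1], [set f | ins _ a.1.2 f \in D.1.2],
   [set f | ins _ a.2 f \in D.2]).
have liveD w : (w \in live D') = (insword i a w \in live D).
  rewrite [LHS]inE /= !inE; have [-> -> ->] := insE w; congr andb.
  apply/forallP/forallP => Sw n; last by have := Sw (lift i n); rewrite letter_ins_lift.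
  by case: (unliftP i n) => [k|] ->; rewrite ?letter_ins_lift ?letter_ins_eq.
have dD' : sdisj (live D').
  apply/sdisjP => s s'; rewrite !liveD => Ds Ds' e.
  rewrite -(insK i a s) -(insK i a s'); congr delword; apply: dD => //.
  have [-> -> ->] := insE s; have [-> -> ->] := insE s'.
  by case: e => ->; [constructor 1 | constructor 2 | constructor 3].
apply: le_trans (ler_wpM2l (v_ge0 Sa) (value_ub U' dD')).
rewrite mulr_sumr (reindex_onto (insword i a) (delword i)) /=; last first.
  by move=> w /andP[_ /andP[_ /eqP <-]]; rewrite delK.
rewrite [leLHS]big_mkcond [leRHS]big_mkcond; apply: ler_sum => w _.
rewrite liveD insK letter_ins_eq !eqxx !andbT.
case: (boolP (insword i a w \in live D)) => //= Dw.
have -> : wt (insword i a w) = v a * wt w.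
  rewrite /wt (bigD1_ord i) //= letter_ins_eq; congr (_ * _).
  by apply: eq_bigr => n _; rewrite letter_ins_lift.
have ge0 : 0 <= v a * wt w.
  by rewrite mulr_ge0 ?v_ge0 // (wt_ge0 (D := D')) // liveD.
case: ifP => [Uw|_]; last by case: ifP.
by have := sU _ Uw (letter_ins_eq _ _ _); rewrite insK => ->.
Qed.


Lemma value_gt0P N (U : {set word N}) : 0 < value U ->
  exists2 w, w \in U & forall n, letter w n \in S /\ 0 < v (letter w n).
Proof.
have [D dD ->] := value_attained U => U0.
have [/existsP[w /and3P[Dw Uw w0]]|/existsPn noU] :=
  boolP [exists w, [&& w \in live D, w \in U & wt w != 0]]; last first.
  move: U0; rewrite big1 ?ltxx // => w /andP[Dw Uw].
  by have := noU w; rewrite Dw Uw /= negbK => /eqP.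
exists w => // n; have Sn := live_letter n Dw; split=> //.
by rewrite lt_neqAle eq_sym (prodf_neq0 _ _ w0) // v_ge0.
Qed.

Lemma value_le_exp N (U : {set word N}) (B : R) : 0 <= B ->
  (forall a, a \in S -> v a <= B) -> value U <= (#|{: I * J * K}|%:R * B) ^+ N.
Proof.
move=> B0 vB; have [D dD ->] := value_attained U.
apply: (@le_trans _ _ (\sum_(w : word N) B ^+ N)); last first.
  rewrite sumr_const exprMn -[leLHS]mulr_natl -natrX.
  by rewrite !card_prod !card_ffun !card_ord !expnMn.
rewrite [leLHS]big_mkcond; apply: ler_sum => w _.
case: ifP => [/andP[Dw _]|_]; last by rewrite exprn_ge0.
rewrite -[X in B ^+ X]card_ord -prodr_const; apply: ler_prod => n _.
by have Sn := live_letter n Dw; rewrite v_ge0 ?vB.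
Qed.

(** * Letter counts and joint types *)

Definition pcount N (p : pred (I * J * K)) (w : word N) : nat :=
  #|[set n | p (letter w n)]|.

Lemma pcountE N p (w : word N) : pcount p w = (\sum_n p (letter w n))%N.
Proof.
rewrite /pcount -sum1_card [RHS](eq_bigr (fun n => if p (letter w n) then 1 else 0)%N).
  by rewrite -big_mkcond; apply: eq_bigl => n; rewrite inE.
by move=> n _; case: (p _).
Qed.

Lemma pcount_cat N1 N2 p (w1 : word N1) (w2 : word N2) :
  pcount p (catword w1 w2) = (pcount p w1 + pcount p w2)%N.
Proof.
rewrite !pcountE big_split_ord; congr (_ + _)%N; apply: eq_bigr => n _.
  by rewrite letter_catl.
by rewrite letter_catr.
Qed.

Lemma pcount_del N p (w : word N.+1) i :
  pcount p w = (p (letter w i) + pcount p (delword i w))%N.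
Proof.
rewrite !pcountE (bigD1_ord i) //=; congr addn.
by apply: eq_bigr => n _; rewrite letter_mkword.
Qed.

Lemma pcount_sum N (p : pred (I * J * K)) (w : word N) :
  pcount p w = (\sum_(a | p a) pcount (pred1 a) w)%N.
Proof.
rewrite pcountE; under [RHS]eq_bigr do rewrite pcountE.
rewrite exchange_big; apply: eq_bigr => n _ /=.
case: (boolP (p (letter w n))) => pn.
  rewrite (bigD1 (letter w n)) //= eqxx big1 // => a /andP[_].
  by rewrite eq_sym => /negPf->.
rewrite big1 // => a pa; case: eqP => // e.
by rewrite e pa in pn.
Qed.

(** A type class in the sense of the method of types; it is empty unless [k] sums to [N]. *)
Definition jtype N (k : I * J * K -> nat) : {set word N} :=
  [set w | [forall a, pcount (pred1 a) w == k a]].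

Lemma jtypeP N k (w : word N) :
  reflect (forall a, pcount (pred1 a) w = k a) (w \in jtype N k).
Proof. by rewrite inE; apply: (iffP forallP) => e a; apply/eqP. Qed.

Lemma jtype_gt0 N k : 0 < value (jtype N k) ->
  (\sum_a k a)%N = N /\ forall a, (0 < k a)%N -> a \in S /\ 0 < v a.
Proof.
move=> /value_gt0P[w /jtypeP kw vw]; split.
  under eq_bigr do rewrite -kw.
  by rewrite -(pcount_sum xpredT) /pcount cardsE card_ord.
move=> a; rewrite -kw /pcount => /card_gt0P[n]; rewrite inE => /eqP <-.
exact: vw.
Qed.

(** Double counting: each word of type [k] has the letter [a] at exactly [k a] positions, and for
    each of the [N + 1] positions the words with [a] there are bounded by [value_del]. *)
Lemma value_jtype_del N k a : a \in S ->
  (k a)%:R * value (jtype N.+1 k) <=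
  N.+1%:R * (v a * value (jtype N (fun b => (k b - (b == a))%N))).
Proof.
move=> Sa; have [D dD ->] := value_attained (jtype N.+1 k).
have -> : (k a)%:R * \sum_(w in live D | w \in jtype N.+1 k) wt w =
  \sum_(i < N.+1) \sum_(w in live D | (w \in jtype N.+1 k) && (letter w i == a)) wt w.
  under [RHS]eq_bigr do under eq_bigl do rewrite andbA.
  under [RHS]eq_bigr do rewrite big_mkcondr.
  rewrite exchange_big mulr_sumr; apply: eq_bigr => w /andP[_ /jtypeP kw] /=.
  rewrite -big_mkcond sumr_const mulr_natl -kw; congr (_ *+ _).
  by apply: eq_card => i; rewrite !inE.
apply: (@le_trans _ _ (\sum_(i < N.+1) v a * value (jtype N (fun b => (k b - (b == a))%N)))).
  apply: ler_sum => i _; apply: value_del => // w /jtypeP kw wi.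
  apply/jtypeP => b; rewrite -kw (pcount_del _ w i) wi /= [a == b]eq_sym.
  by rewrite addKn.
by rewrite sumr_const card_ord mulr_natl.
Qed.

(* Iterating [value_jtype_del], always deleting a letter with the largest
   excess. *)
Lemma value_jtype_sub (B : R) : 0 <= B -> (forall a, a \in S -> v a <= B) ->
  forall d n (k k' : I * J * K -> nat), (forall a, k' a <= k a)%N ->
  (\sum_a k a)%N = (n + d)%N -> (\sum_a k' a)%N = n ->
  value (jtype (n + d) k) <=
  'C(n + d, d)%:R * (#|{: I * J * K}|%:R * B) ^+ d * value (jtype n k').
Proof.
move=> B0 vB; elim=> [|d IHd] n k k' le_k' sk sk'.
  rewrite addn0 bin0 !mul1r; apply: le_value => w _ /jtypeP kw.
  apply/jtypeP => a; rewrite kw.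
  apply/eqP; rewrite eqn_leq le_k' andbT leqNgt; apply/negP => lt_a.
  have : (\sum_a k' a < \sum_a k a)%N.
    by rewrite (bigD1 a) // [leqRHS](bigD1 a) //= -addSn leq_add // leq_sum.
  by rewrite sk sk' addn0 ltnn.
(* Pigeonhole: the excess of [k] over [k'] totals [d + 1], so some letter has at least the average
   excess. *)
have [a le_d] : exists a, (d < #|{: I * J * K}| * (k a - k' a))%N.
  apply/existsP; apply: contraT => /existsPn no_a.
  have : (#|{: I * J * K}| * \sum_a (k a - k' a) <= \sum_(a : I * J * K) d)%N.
    by rewrite big_distrr /=; apply: leq_sum => a _; have := no_a a; rewrite -leqNgt.
  rewrite sumnB // sk sk' addKn sum_nat_const leq_mul2l ltnn orbF => /eqP L0.
  move: sk; rewrite big1 ?addnS // => a _.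
  suff : (0 < #|{: I * J * K}|)%N by rewrite L0.
  by apply/card_gt0P; exists a.
have ka : (k' a < k a)%N.
  by rewrite ltnNge; apply: contraTN le_d; rewrite -subn_eq0 => /eqP->; rewrite muln0.
(* A zero value is trivial; a positive one puts [a], which occurs in [k], into [S]. *)
have [->|V0] := eqVneq (value (jtype (n + d.+1) k)) 0.
  by rewrite !mulr_ge0 ?exprn_ge0 ?mulr_ge0 // value_ge0.
have /jtype_gt0[_ /(_ a (leq_ltn_trans (leq0n _) ka))[Sa va]] :
  0 < value (jtype (n + d.+1) k) by rewrite lt_neqAle eq_sym V0 value_ge0.
move: V0 => _; rewrite addnS in sk *.
set kd : I * J * K -> nat := fun b => (k b - (b == a))%N.
have skd : (\sum_a kd a)%N = (n + d)%N.
  apply/eqP; rewrite -eqSS -sk (bigD1 a) //= [eqbRHS](bigD1 a) //= /kd eqxx.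
  rewrite -addSn subn1 prednK ?(leq_ltn_trans _ ka) //; apply/eqP.
  by congr addn; apply: eq_bigr => b /negPf->; rewrite subn0.
have le_kd b : (k' b <= kd b)%N.
  rewrite /kd; case: eqP => [->|_]; last by rewrite subn0.
  by rewrite subn1 -ltnS prednK // (leq_ltn_trans _ ka).
have := IHd n kd k' le_kd skd sk'.
set L := #|{: _}|; set M := value _; set M' := value _ => le_M.
have le1 := value_jtype_del (n + d) k Sa; rewrite -/kd -/M in le1.
set V := value _ in le1 *.
have V0 : 0 <= V := value_ge0 _.
have M0 : 0 <= M := value_ge0 _.
(* After multiplication by [d + 1] the bound follows from [d + 1 <= L * k a], one deletion, the
   induction hypothesis, and [(d + 1) * 'C(n + d + 1, d + 1) = (n + d + 1) * 'C(n + d, d)]. *)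
rewrite -(ler_pM2l (ltr0Sn R d)).
apply: (@le_trans _ _ (L%:R * ((k a)%:R * V))).
  rewrite mulrA -natrM ler_wpM2r // ler_nat (leq_trans le_d) //.
  by rewrite leq_mul2l leq_subr orbT.
apply: (@le_trans _ _ (L%:R * ((n + d).+1%:R * (v a * M)))).
  by rewrite ler_wpM2l.
apply: (@le_trans _ _ (L%:R * ((n + d).+1%:R * (B *
   ('C(n + d, d)%:R * (L%:R * B) ^+ d * M'))))).
  by rewrite !ler_wpM2l // ler_pM ?vB // ltW.
rewrite [leRHS]mulrA [d.+1%:R * _]mulrA -natrM -mul_bin_diag /= natrM exprS.
by rewrite le_eqVlt; apply/orP; left; apply/eqP; ring.
Qed.

(** Each letter count lies between 0 and [N], so the joint types are polynomially many; the best of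
    them carries at least the average share of the value. *)
Lemma value_le_jtype N (U : {set word N}) :
  exists k, value U <= N.+1%:R ^+ #|{: I * J * K}| * value (jtype N k).
Proof.
pose V (k : {ffun I * J * K -> 'I_N.+1}) := jtype N (fun a => k a).
pose f (w : word N) : {ffun I * J * K -> 'I_N.+1} :=
  [ffun a => inord (pcount (pred1 a) w)].
have fU w : w \in U -> w \in V (f w).
  move=> _; apply/jtypeP => a; rewrite ffunE inordK //.
  by rewrite ltnS /pcount -[leqRHS]card_ord max_card.
pose F k := value (V k).
have [k _ kmax] := arg_maxP F (erefl (xpredT [ffun _ => ord0])).
exists (fun a => nat_of_ord (k a)); apply: le_trans (value_le_sum fU) _.
apply: (@le_trans _ _ (\sum_(k' : {ffun I * J * K -> 'I_N.+1}) F k)).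
  by apply: ler_sum => k' _; apply: kmax.
by rewrite sumr_const card_ffun card_ord -natrX mulr_natl.
Qed.

(** * Rotation of words *)

Section Cyclic.
Variables (hI : I -> J) (hJ : J -> K) (hK : K -> I).
Hypotheses (hI_inj : injective hI) (hJ_inj : injective hJ) (hK_inj : injective hK).

(** Models the symmetry of the product of a tensor with its two rotations; [hI], [hJ], [hK] rename
    the index sets. *)
Definition cyc (a : I * J * K) : I * J * K := (hK a.2, hI a.1.1, hJ a.1.2).

Lemma cyc_inj : injective cyc.
Proof. by move=> [[x y] z] [[x' y'] z'] [/hK_inj-> /hI_inj-> /hJ_inj->]. Qed.

Hypothesis cycS : forall a, (cyc a \in S) = (a \in S).
Hypothesis cycv : forall a, v (cyc a) = v a.

Definition cycword N (w : word N) : word N := mkword (fun n => cyc (letter w n)).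

Lemma cycword_inj N : injective (@cycword N).
Proof.
move=> w w' e; apply: wordP => n; apply: cyc_inj.
by have := congr1 (fun w => letter w n) e; rewrite !letter_mkword.
Qed.

(** Restrictions are pulled back along the rotation. It preserves weights and turns agreement in
    [x], [y], [z] into agreement in [y], [z], [x], so strong disjointness survives. *)
Lemma value_cyc N (U U' : {set word N}) :
  (forall w, cycword w \in U -> w \in U') -> value U <= value U'.
Proof.
move=> sU; have [D /sdisjP dD ->] := value_attained U.
pose D' : restriction N :=
  ([set f : {ffun 'I_N -> I} | [ffun n => hI (f n)] \in D.1.2],
   [set f : {ffun 'I_N -> J} | [ffun n => hJ (f n)] \in D.2],
   [set f : {ffun 'I_N -> K} | [ffun n => hK (f n)] \in D.1.1]).
have cE (w : word N) : [/\ (cycword w).1.1 = [ffun n => hK (w.2 n)],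
                (cycword w).1.2 = [ffun n => hI (w.1.1 n)]
              & (cycword w).2 = [ffun n => hJ (w.1.2 n)]].
  by split; apply/ffunP => n; rewrite !ffunE.
have liveD w : (w \in live D') = (cycword w \in live D).
  rewrite [LHS]inE /= !inE; have [-> -> ->] := cE w; congr andb.
    by apply: eq_forallb => n; rewrite letter_mkword cycS.
  by rewrite [RHS]andbC -andbA.
have dD' : sdisj (live D').
  apply/sdisjP => s s'; rewrite !liveD => Ds Ds' e.
  apply: cycword_inj; apply: dD => //.
  have [-> -> ->] := cE s; have [-> -> ->] := cE s'.
  by case: e => ->; [constructor 2 | constructor 3 | constructor 1].
apply: le_trans (value_ub U' dD').
rewrite (reindex_inj (@cycword_inj N)) /=.
rewrite [leLHS]big_mkcond [leRHS]big_mkcond; apply: ler_sum => w _.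
rewrite -liveD; have -> : wt (cycword w) = wt w.
  by apply: eq_bigr => n _; rewrite letter_mkword cycv.
case: (boolP (w \in live D')) => //= Dw.
by case: ifP => [/sU->//|_]; case: ifP => // _; apply: wt_ge0 Dw.
Qed.

End Cyclic.
End Words.

(** * Marginal types *)

Section MarginalTypes.
Variables (R : realFieldType) (I J K L : finType) (S : {set L}) (v : L -> R).
Hypothesis v_ge0 : forall s, s \in S -> 0 <= v s.
Variables p1 p2 p3 : I * J * K -> L.

(** A letter has three factors [p1], [p2], [p3] over the common alphabet [L]; [triS] and [triv] are
    the support and the values of the threefold product. *)
Definition triS : {set I * J * K} :=
  [set a | [&& p1 a \in S, p2 a \in S & p3 a \in S]].
Definition triv (a : I * J * K) : R := v (p1 a) * v (p2 a) * v (p3 a).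

Lemma triv_ge0 a : a \in triS -> 0 <= triv a.
Proof. by rewrite inE => /and3P[? ? ?]; rewrite !mulr_ge0 ?v_ge0. Qed.

(** The three marginals are kept apart because rotation permutes them; the value at a distribution
    uses equal ones. *)
Definition mtype N (c1 c2 c3 : L -> nat) : {set word I J K N} :=
  [set w : word I J K N | [forall s in S, [&& pcount (fun a => p1 a == s) w == c1 s,
     pcount (fun a => p2 a == s) w == c2 s &
     pcount (fun a => p3 a == s) w == c3 s]]].

Lemma mtypeP N c1 c2 c3 (w : word I J K N) :
  reflect (forall s, s \in S -> [/\ pcount (fun a => p1 a == s) w = c1 s,
     pcount (fun a => p2 a == s) w = c2 s &
     pcount (fun a => p3 a == s) w = c3 s]) (w \in mtype N c1 c2 c3).
Proof.
rewrite inE; apply: (iffP forall_inP) => cw s Ss.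
  by have /and3P[/eqP-> /eqP-> /eqP->] := cw s Ss.
by have [-> -> ->] := cw s Ss; rewrite !eqxx.
Qed.

Definition mval N (c1 c2 c3 : L -> nat) : R :=
  value triS triv (mtype N c1 c2 c3).

Lemma mval_ge0 N c1 c2 c3 : 0 <= mval N c1 c2 c3.
Proof. exact/value_ge0/triv_ge0. Qed.

Lemma eq_mval N c1 c2 c3 d1 d2 d3 :
  {in S, c1 =1 d1} -> {in S, c2 =1 d2} -> {in S, c3 =1 d3} ->
  mval N c1 c2 c3 = mval N d1 d2 d3.
Proof.
move=> e1 e2 e3; congr value; apply/setP => w.
by apply/mtypeP/mtypeP => cw s Ss; have := cw s Ss; rewrite e1 ?e2 ?e3.
Qed.

Arguments eq_mval {N c1 c2 c3} d1 d2 d3.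

Lemma mval_mul N N' c1 c2 c3 d1 d2 d3 :
  mval N c1 c2 c3 * mval N' d1 d2 d3 <=
  mval (N + N') (fun s => c1 s + d1 s)%N (fun s => c2 s + d2 s)%N
    (fun s => c3 s + d3 s)%N.
Proof.
apply: (value_mul triv_ge0) => w w' /mtypeP cw /mtypeP dw.
apply/mtypeP => s Ss; rewrite !pcount_cat.
by have [-> -> ->] := cw s Ss; have [-> -> ->] := dw s Ss.
Qed.

Lemma mval_jtype N k : value triS triv (jtype N k) <=
  mval N (fun s => \sum_(a | p1 a == s) k a)%N
         (fun s => \sum_(a | p2 a == s) k a)%N
         (fun s => \sum_(a | p3 a == s) k a)%N.
Proof.
apply: (le_value triv_ge0) => w _ /jtypeP kw; apply/mtypeP => s _.
by split; rewrite pcount_sum; apply: eq_bigr => a _; rewrite kw.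
Qed.

Lemma mval_exp N c q : mval N c c c ^+ q <=
  mval (q * N) (fun s => q * c s)%N (fun s => q * c s)%N (fun s => q * c s)%N.
Proof.
elim: q => [|q IHq].
  (* The empty word has weight 1, which settles [q = 0]. *)
  pose w : word I J K 0 := mkword (fun n : 'I_0 => match notF (ltn_ord n) with end).
  have := @value_ge_wt _ _ _ _ triS triv triv_ge0 0
    (mtype 0 (fun s => 0 * c s)%N (fun s => 0 * c s)%N (fun s => 0 * c s)%N) w.
  rewrite /wt big_ord0 expr0 mul0n; apply; first by case.
  by apply/mtypeP => s _; rewrite !pcountE !big_ord0 mul0n.
rewrite exprS mulSn; apply: le_trans (ler_wpM2l (mval_ge0 _ _ _ _) IHq) _.
by apply: le_trans (mval_mul _ _ _ _ _ _ _ _) _; rewrite (eq_mval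
  (fun s => (q.+1 * c s)%N) (fun s => (q.+1 * c s)%N)
  (fun s => (q.+1 * c s)%N)) // => s _; rewrite mulSn.
Qed.

Hypothesis diag : forall s, exists a, [/\ p1 a = s, p2 a = s & p3 a = s].

(** The diagonal letter, whose three factors all equal [s], has value [v s ^+ 3] and forms a word of
    length 1 with all marginals concentrated at [s]. *)
Lemma mval1_ge s : s \in S ->
  v s ^+ 3 <= mval 1 (fun t => s == t) (fun t => s == t) (fun t => s == t).
Proof.
move=> Ss; have [a [a1 a2 a3]] := diag s.
have := @value_ge_wt _ _ _ _ triS triv triv_ge0 1
  (mtype 1 (fun t => s == t) (fun t => s == t) (fun t => s == t))
  (mkword (fun=> a)).
rewrite /wt big_ord1 letter_mkword /triv a1 a2 a3 !exprS mulr1 mulrA; apply.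
  by move=> n; rewrite letter_mkword inE a1 a2 a3 Ss.
by apply/mtypeP => t _; rewrite !pcountE !big_ord1 !letter_mkword a1 a2 a3.
Qed.

(** Fill up the type [c] to [c'] one position at a time, always with a diagonal letter, which
    contributes a factor of at least [B]. *)
Lemma mval_extend (B : R) d n (c c' : L -> nat) : 0 <= B ->
  (forall s, s \in S -> (c s <= c' s)%N) ->
  (forall s, s \in S -> (0 < c' s)%N -> B <= v s ^+ 3) ->
  (\sum_(s in S) c' s = \sum_(s in S) c s + d)%N ->
  mval n c c c * B ^+ d <= mval (n + d) c' c' c'.
Proof.
move=> B0; elim: d n c => [|d IHd] n c le_c vB sum_c'.
  have e : {in S, c =1 c'}.
    move=> s Ss; apply/eqP; rewrite eqn_leq le_c //= leqNgt; apply/negP => lt_s.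
    have : (\sum_(s in S) c s < \sum_(s in S) c' s)%N.
      rewrite (bigD1 s) // [leqRHS](bigD1 s) //= -addSn leq_add //.
      by apply: leq_sum => t /andP[/le_c].
    by rewrite sum_c' addn0 ltnn.
  by rewrite addn0 mulr1 (eq_mval c' c' c').
have [s /andP[Ss lt_s]] : exists s, (s \in S) && (c s < c' s)%N.
  apply/existsP; apply: contraT => /existsPn no_s.
  have : (\sum_(s in S) c' s <= \sum_(s in S) c s)%N.
    by apply: leq_sum => s Ss; have := no_s s; rewrite Ss -leqNgt.
  by rewrite sum_c' addnS ltnNge leq_addr.
pose c1 t := (c t + (s == t))%N.
have le_c1 t : t \in S -> (c1 t <= c' t)%N.
  by move=> St; rewrite /c1; case: eqP => [<-|_]; rewrite ?addn1 // addn0 le_c.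
have sum_c1 : (\sum_(s in S) c' s = \sum_(s in S) c1 s + d)%N.
  rewrite sum_c' big_split /= -addnA; congr addn.
  rewrite (bigD1 s) //= eqxx big1 // => t /andP[_].
  by rewrite eq_sym => /negPf->.
have := IHd (n + 1)%N c1 le_c1 vB sum_c1; rewrite -addnA add1n; apply: le_trans.
rewrite exprS mulrA ler_wpM2r ?exprn_ge0 //.
apply: le_trans (mval_mul _ _ _ _ _ _ _ _).
apply: ler_wpM2l; first exact: mval_ge0.
apply: le_trans (mval1_ge Ss); apply: vB => //.
exact: leq_ltn_trans lt_s.
Qed.

Variables (hI : I -> J) (hJ : J -> K) (hK : K -> I).
Hypotheses (hI_inj : injective hI) (hJ_inj : injective hJ) (hK_inj : injective hK).
Hypothesis p1_cyc : forall a, p1 (cyc hI hJ hK a) = p2 a.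
Hypothesis p2_cyc : forall a, p2 (cyc hI hJ hK a) = p3 a.
Hypothesis p3_cyc : forall a, p3 (cyc hI hJ hK a) = p1 a.

(** The rotation permutes the three factors cyclically, hence also the three marginals. *)
Lemma mval_cyc N c1 c2 c3 : mval N c1 c2 c3 <= mval N c3 c1 c2.
Proof.
apply: (value_cyc triv_ge0 hI_inj hJ_inj hK_inj).
- by move=> a; rewrite !inE p1_cyc p2_cyc p3_cyc andbA andbC.
- by move=> a; rewrite /triv p1_cyc p2_cyc p3_cyc mulrC mulrA.
move=> w /mtypeP cw; apply/mtypeP => s Ss; have := cw s Ss; rewrite !pcountE.
under eq_bigr do rewrite letter_mkword p1_cyc.
under [in X in [/\ _, X & _]]eq_bigr do rewrite letter_mkword p2_cyc.
under [in X in [/\ _, _ & X]]eq_bigr do rewrite letter_mkword p3_cyc.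
by case.
Qed.

(** Multiply by both rotations: each of the three marginals of the product collects [c1], [c2] and
    [c3] once. *)
Lemma mval_symmetrize N c1 c2 c3 (c := fun s => (c1 s + c2 s + c3 s)%N) :
  mval N c1 c2 c3 ^+ 3 <= mval (N + N + N) c c c.
Proof.
have V0 := mval_ge0 N.
apply: (@le_trans _ _ (mval N c1 c2 c3 * mval N c3 c1 c2 * mval N c2 c3 c1)).
  rewrite !exprS mulr1 mulrA; have le1 := mval_cyc N c1 c2 c3.
  have le2 := le_trans le1 (mval_cyc N c3 c1 c2).
  by rewrite !ler_pM ?mulr_ge0.
apply: le_trans (ler_wpM2r (V0 _ _ _) (mval_mul _ _ _ _ _ _ _ _)) _.
apply: le_trans (mval_mul _ _ _ _ _ _ _ _) _.
by rewrite (eq_mval c c c) // => s _; rewrite /c; lia.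
Qed.

End MarginalTypes.
Arguments eq_mval {R I J K L S v p1 p2 p3 N c1 c2 c3} d1 d2 d3.

(** * Exponential rates *)

Local Open Scope classical_set_scope.
Local Open Scope ring_scope.

Section Rates.
Variable R : realType.
Implicit Types (m : nat -> R) (l C eta : R).

(** Convergence of [a n / n] to [l], written without division. *)
Definition rate (a : nat -> R) l := forall eta, 0 < eta ->
  exists N0, forall n, (N0 <= n)%N -> n%:R * (l - eta) <= a n <= n%:R * (l + eta).

(** Approximate form of Fekete's lemma: if every late ratio [a n / n] is, up to [eta], an eventual
    lower bound of the ratios, then the limit is the supremum [sup E] of the eventual lower
    bounds. *)
Lemma rate_exists (a : nat -> R) C : (forall n, (0 < n)%N -> - (C * n%:R) <= a n <= C * n%:R) ->
  (forall eta, 0 < eta -> exists N0, forall n, (N0 <= n)%N -> (0 < n)%N ->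
     exists M0, forall M, (M0 <= M)%N -> M%:R * (a n / n%:R - eta) <= a M) ->
  exists l, rate a l.
Proof.
move=> aC a_lim.
pose E := [set x : R | exists N, forall M, (N <= M)%N -> M%:R * x <= a M].
have E_ub : ubound E C.
  move=> x [N Nx]; have := Nx N.+1 (leqnSn _); have /andP[_] := aC N.+1 isT.
  move=> aN /le_trans/(_ aN); rewrite mulrC ler_pM2r //.
have supE : has_sup E.
  split; last by exists C.
  exists (- C), 1%N => M M1; have /andP[+ _] := aC M M1.
  by rewrite mulrN mulrC.
exists (sup E) => eta eta0.
have [N0 hN0] := a_lim _ eta0.
have [x [N1 hx] lt_x] := sup_adherent eta0 supE.
exists (maxn 1 (maxn N0 N1)) => n; rewrite !geq_max => /and3P[n0 nN0 nN1].
have nR : 0 < n%:R :> R by rewrite ltr0n.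
apply/andP; split.
  by apply: le_trans (hx n nN1); rewrite ler_pM2l // ltW.
have : a n / n%:R - eta <= sup E by apply: sup_upper_bound => //; apply: hN0.
by rewrite lerBlDr ler_pdivrMr // mulrC.
Qed.

Lemma rate_le a b l k : (exists N, forall n, (N <= n)%N -> a n <= b n) ->
  rate a l -> rate b k -> l <= k.
Proof.
move=> [N ab] al bk; apply/ler_addgt0Pr => e e0.
have [N1 h1] := al (e / 2) (divr_gt0 e0 (ltr0Sn _ 1)).
have [N2 h2] := bk (e / 2) (divr_gt0 e0 (ltr0Sn _ 1)).
pose n := maxn 1 (maxn N (maxn N1 N2)).
have : (maxn 1 (maxn N (maxn N1 N2)) <= n)%N by [].
rewrite !geq_max => /and4P[n1 nN nN1 nN2].
have nR : 0 < n%:R :> R by rewrite ltr0n.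
have /andP[la _] := h1 n nN1; have /andP[_ bu] := h2 n nN2.
have := le_trans (le_trans la (ab n nN)) bu.
by rewrite ler_pM2l // lerBlDr -addrA -splitr.
Qed.

Lemma rate_mull x : rate (fun n => n%:R * x) x.
Proof.
move=> e e0; exists 0%N => n _.
by rewrite !ler_wpM2l // (gerBl, lerDl) ltW.
Qed.

(** Let [eta] tend to 0; the restriction to [eta <= 1] allows terms quadratic in [eta] to be
    absorbed in [C]. *)
Lemma le_of_small_loss l k C : 0 <= C ->
  (forall eta, 0 < eta <= 1 -> l - C * eta <= k) -> l <= k.
Proof.
move=> C0 lk; apply/ler_addgt0Pr => e e0.
have C1 : 0 < C + 1 by rewrite ltr_wpDl.
pose eta := Num.min 1 (e / (C + 1)).
have eta0 : 0 < eta by rewrite lt_min ltr01 divr_gt0.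
have /lk : 0 < eta <= 1 by rewrite eta0 ge_min lexx.
rewrite lerBlDr => /le_trans; apply; rewrite lerD2l.
have : eta * (C + 1) <= e by rewrite -ler_pdivlMr // ge_min lexx orbT.
by nra.
Qed.

(** For [n > 0] the power is the exponential of [ln (m n) / (3 * n)], and the exponential is
    continuous. *)
Lemma powR_rate m l : (forall n, (0 < n)%N -> 0 < m n) ->
  rate (fun n => ln (m n)) l ->
  (fun n => m n `^ (3 * n)%:R^-1) @ \oo --> expR (l / 3).
Proof.
move=> m0 ml.
have cv : (fun n => ln (m n) / (3 * n)%:R) @ \oo --> l / 3.
  apply/cvgrPdist_le => e e0; have [N hN] := ml e e0.
  exists (maxn 1 N) => // n /=; rewrite geq_max => /andP[n0 nN].
  have nR : 0 < n%:R :> R by rewrite ltr0n.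
  have /andP[h1 h2] := hN n nN; rewrite ler_distlC natrM.
  rewrite invfM [_ * (n%:R^-1)]mulrC mulrA; apply/andP; split.
    rewrite ler_pdivlMr // mulrBl divfK //.
    have : l - e <= ln (m n) / n%:R by rewrite ler_pdivlMr // mulrC.
    by move=> ?; lra.
  have : ln (m n) / n%:R <= l + e by rewrite ler_pdivrMr // mulrC.
  by move=> ?; lra.
have cvE : expR (ln (m n) / (3 * n)%:R) @[n --> \oo] --> expR (l / 3).
  by apply: continuous_cvg cv; exact: continuous_expR.
apply: cvg_trans cvE.
apply: near_eq_cvg.
exists 1%N => // n /= n0; rewrite /powR gt_eqF ?m0 //.
by rewrite mulrC.
Qed.

(** * Subexponential factors, cluster points and choice of multiplicities *)

Lemma ln_natS_sublinear (k eta : R) : 0 <= k -> 0 < eta ->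
  exists N0, forall N, (N0 <= N)%N -> k * ln (N.+1%:R) <= eta * N%:R.
Proof.
(* The inequality [ln y <= y - 1] is used at [y = (N + 1) * x]; this [x] makes its linear part cost
   at most [eta / 2] per unit of [N], and the constants are absorbed for large [N]. *)
move=> k0 eta0; pose x := eta / (2 * (k + 1)).
have k1 : 0 < 2 * (k + 1) by rewrite mulr_gt0 // ltr_wpDl.
have x0 : 0 < x by rewrite divr_gt0.
have xk : k * x <= eta / 2.
  have : x * (2 * (k + 1)) = eta by rewrite divfK ?gt_eqF.
  by move=> ?; nra.
exists (Num.trunc ((k * (x - ln x)) * 2 / eta)).+1 => N NN.
have NR : k * (x - ln x) <= eta / 2 * N%:R.
  have : k * (x - ln x) * 2 / eta <= N%:R.
    by apply: le_trans (ltW (truncnS_gt _)) _; rewrite ler_nat.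
  by rewrite ler_pdivrMr // => ?; lra.
have : ln (N.+1%:R * x) <= N.+1%:R * x - 1.
  have := @le_ln1Dx R (N.+1%:R * x - 1); rewrite addrCA subrr addr0; apply.
  by rewrite ltrBrDr addNr mulr_gt0.
rewrite lnM ?posrE // -natr1 => h.
have : k * ln (N%:R + 1) <= k * ((N%:R + 1) * x - ln x) by rewrite ler_wpM2l //; lra.
have : k * x * N%:R <= eta / 2 * N%:R by rewrite ler_wpM2r.
by nra.
Qed.

Lemma bin_exp_le (N d : nat) (x : R) : 0 <= x -> (d <= N)%N ->
  'C(N, d)%:R * x ^+ d <= (1 + x) ^+ N.
Proof.
move=> x0 dN; rewrite exprDn.
have dN1 : (d < N.+1)%N by [].
rewrite (bigD1 (Ordinal dN1)) //= expr1n mul1r mulr_natl lerDl.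
by apply: sumr_ge0 => i _; rewrite mulrn_wge0 // mulr_ge0 ?exprn_ge0.
Qed.

(** Take logarithms in ['C(N, d) * x ^+ d <= (1 + x) ^+ N] with [x = eta / 2]: the right side costs
    [eta / 2 * N], and [delta] makes the terms linear in [d] equally small. *)
Lemma ln_bin_sublinear (K eta : R) : 0 < eta ->
  exists2 delta : R, 0 < delta & forall N d : nat, (d <= N)%N ->
    d%:R <= delta * N%:R -> ln ('C(N, d)%:R) + d%:R * K <= eta * N%:R.
Proof.
move=> eta0; pose x := eta / 2; have x0 : 0 < x by rewrite divr_gt0.
pose A := `|K - ln x| + 1; have A0 : 0 < A by rewrite ltr_wpDl.
exists (eta / 2 / A) => [|N d dN hd]; first by rewrite !divr_gt0.
have bin0 : 0 < 'C(N, d)%:R :> R by rewrite ltr0n bin_gt0.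
have : ln ('C(N, d)%:R * x ^+ d) <= ln ((1 + x) ^+ N).
  by rewrite ler_ln ?posrE ?bin_exp_le ?mulr_gt0 ?exprn_gt0 ?addr_gt0 // ltW.
rewrite lnM ?posrE ?exprn_gt0 // !lnXn ?addr_gt0 // => h.
have h1 : ln (1 + x) *+ N <= x * N%:R.
  rewrite -[leLHS]mulr_natr ler_wpM2r // le_ln1Dx //; lra.
have h2 : d%:R * (K - ln x) <= d%:R * A.
  by rewrite ler_wpM2l // /A (le_trans (ler_norm _)) // lerDl.
have h3 : d%:R * A <= eta / 2 * N%:R.
  by rewrite -ler_pdivlMr // mulrAC.
rewrite -[ln x *+ d]mulr_natr in h; rewrite /x in h h1 h2 *.
by nra.
Qed.

(** Tychonoff's theorem gives a cluster point in the cube; as [L] is finite, closeness can be asked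
    of all coordinates at once. *)
Lemma cluster_seq (L : finType) (f : nat -> L -> R) :
  (forall n a, 0 <= f n a <= 1) ->
  exists Q : L -> R, forall delta, 0 < delta -> forall N0,
    exists2 N, (N0 <= N)%N & forall a, `|f N a - Q a| < delta.
Proof.
move=> f01.
have cpt := @tychonoff L (fun=> R) (fun=> `[0, 1]%classic)
   (fun=> @segment_compact R 0 1).
have [|Q [_ Qcl]] := cpt (f @ \oo) _.
  by exists 0%N => // n _ a /=; rewrite in_itv /= f01.
exists Q => delta delta0 N0.
have [] := Qcl [set f N | N in [set N | (N0 <= N)%N]]
  [set g : L -> R | forall a, `|g a - Q a| < delta].
- by exists N0 => // n /= nN; exists n.
- apply: (@filter_forall _ L (fun a (g : L -> R) => `|g a - Q a| < delta) _
    (@nbhs_filter (prod_topology (fun _ : L => R)) Q)) => a.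
  have : nbhs (Q a) [set y : R | `|y - Q a| < delta].
    by apply/nbhs_ballP; exists delta => // y; rewrite /ball /= distrC.
  exact: (@proj_continuous L (fun=> R) a Q).
by move=> g [[N NN <-] gd]; exists N.
Qed.

(** Chooses how many copies of a type of length [n] go into length [M]. They cover all but a
    fraction [eta] of the positions, and the third bound, multiplied by a probability of at least
    [p], leaves room for a relative error [delta] and for rounding. *)
Lemma quotient_choice (p eta : R) : 0 < p -> 0 < eta ->
  exists2 delta : R, 0 < delta & forall n, (0 < n)%N -> exists M0, forall M, (M0 <= M)%N ->
    exists q, [/\ (q * n <= M)%N, M%:R - (q * n)%:R <= eta * M%:R &
      q%:R * n%:R * (1 + delta / p) <= M%:R - p^-1].
Proof.
move=> p0 eta0; exists (p * eta / 2) => [|n n0]; first by rewrite divr_gt0 // mulr_gt0.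
have -> : p * eta / 2 / p = 2^-1 * eta by field; rewrite gt_eqF.
have nR : 0 < n%:R :> R by rewrite ltr0n.
have pV : 0 < p^-1 by rewrite invr_gt0.
set h := 2^-1 * eta; have h0 : 0 < h by rewrite mulr_gt0.
exists (maxn (Num.trunc (p^-1)).+1 (Num.trunc ((p^-1 + n%:R) / h)).+1) => M.
rewrite geq_max => /andP[M1 M2].
have Mp : p^-1 <= M%:R.
  by apply: le_trans (ltW (truncnS_gt _)) _; rewrite ler_nat.
have MR : p^-1 + n%:R <= h * M%:R.
  rewrite [h * _]mulrC -ler_pdivrMr //.
  by apply: le_trans (ltW (truncnS_gt _)) _; rewrite ler_nat.
have h1 : 0 < 1 + h by rewrite addr_gt0.
have M0 : 0 <= M%:R :> R by [].
set W := M%:R - p^-1; have W0 : 0 <= W by rewrite subr_ge0.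
(* [q] is the largest integer that the third bound allows; the loss is then controlled through
   [(1 - h) * (1 + h) <= 1]. *)
pose y := W / (n%:R * (1 + h)).
have y0 : 0 <= y by rewrite divr_ge0 ?mulr_ge0 // ltW.
have /andP[] := truncn_itv y0; set q := Num.trunc y => qy yq.
exists q.
have qW : q%:R * n%:R * (1 + h) <= W.
  by rewrite -mulrA -ler_pdivlMr // mulr_gt0.
have qW' : W < (q%:R * n%:R + n%:R) * (1 + h).
  rewrite -[X in _ + X]mul1r -mulrDl natr1 -mulrA -ltr_pdivrMr //.
  by rewrite mulr_gt0.
have W1 : W * (1 - h) < q%:R * n%:R + n%:R.
  rewrite -(ltr_pM2r h1); apply: le_lt_trans qW'.
  by rewrite -mulrA -subr_sqr expr1n mulrBr mulr1 lerBlDr lerDl mulr_ge0 ?sqr_ge0.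
have qn0 : 0 <= q%:R * n%:R :> R by rewrite mulr_ge0.
split=> //.
  rewrite -(ler_nat R) natrM; apply: le_trans (_ : W <= _).
    by apply: le_trans qW; rewrite ler_peMr // lerDl ltW.
  by rewrite gerBl ltW.
rewrite natrM; have : h * p^-1 >= 0 by rewrite mulr_ge0 // ltW.
have -> : eta = 2 * h by rewrite /h mulrA divff ?mul1r.
rewrite /W in W1 *; nra.
Qed.

Lemma powR_cvg0 (m : nat -> R) :
  (exists N0, forall n, (N0 <= n)%N -> m n = 0) ->
  (fun n => m n `^ (3 * n)%:R^-1) @ \oo --> (0 : R).
Proof.
move=> [N0 m0]; apply: cvg_near_cst.
(* [n = 0] is excluded, since there the exponent is [0^-1 = 0] and the power is 1. *)
exists (maxn 1 N0) => // n /=; rewrite geq_max => /andP[n0 nN].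
by rewrite m0 // powR0 // invr_neq0 // pnatr_eq0 muln_eq0 /= -lt0n.
Qed.

End Rates.

(** * Asymptotic values of types *)

Lemma fin_pos_min (R : realFieldType) (L : finType) (Q : pred L) (f : L -> R) :
  (forall s, Q s -> 0 < f s) ->
  exists2 p, 0 < p & forall s, Q s -> p <= f s.
Proof.
move=> f0; exists (\big[Order.min/1]_(s | Q s) f s).
  exact: lt_bigmin.
by move=> s Qs; apply: bigmin_le_cond.
Qed.

Section Asymptotics.
Variables (R : realType) (I J K L : finType) (S : {set L}) (v : L -> R).
Hypothesis v_ge0 : forall s, s \in S -> 0 <= v s.
Variables p1 p2 p3 : I * J * K -> L.
Hypothesis diag : forall s, exists a, [/\ p1 a = s, p2 a = s & p3 a = s].
Variables (hI : I -> J) (hJ : J -> K) (hK : K -> I).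
Hypotheses (hI_inj : injective hI) (hJ_inj : injective hJ) (hK_inj : injective hK).
Hypothesis p1_cyc : forall a, p1 (cyc hI hJ hK a) = p2 a.
Hypothesis p2_cyc : forall a, p2 (cyc hI hJ hK a) = p3 a.
Hypothesis p3_cyc : forall a, p3 (cyc hI hJ hK a) = p1 a.

Let SS := triS S p1 p2 p3.
Let vv := triv v p1 p2 p3.
Let A : R := #|{: I * J * K}|%:R.
(** A common bound of all letter values; the added 1 keeps it positive. *)
Let B : R := \sum_(a in SS) vv a + 1.
Let mv N (c : L -> nat) : R := mval S v p1 p2 p3 N c c c.
Let tot N : R := value SS vv [set: word I J K N]%SET.

Let vv_ge0 a : a \in SS -> 0 <= vv a.
Proof. exact: triv_ge0. Qed.

Let A0 : 0 <= A. Proof. by []. Qed.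

Let B0 : 0 < B.
Proof. by rewrite ltr_wpDl // sumr_ge0. Qed.

Let vv_le a : a \in SS -> vv a <= B.
Proof.
move=> Sa; rewrite /B (bigD1 a) //= -addrA lerDl addr_ge0 // sumr_ge0 // => b /andP[+ _].
exact: vv_ge0.
Qed.

(** A single constant on the logarithmic scale: it bounds the growth per letter from above and the
    cubed values on [Q] from below. *)
Lemma bounding_constant (Q : pred L) : (forall s, Q s -> 0 < v s) ->
  exists C, [/\ 0 <= C, A * B <= expR C & forall s, Q s -> expR (- C) <= v s ^+ 3].
Proof.
move=> vQ; have [|p p0 pv] := @fin_pos_min _ _ Q (fun s => v s ^+ 3).
  by move=> s /vQ; apply: exprn_gt0.
have AB : 0 <= A * B by rewrite mulr_ge0 // ltW.
have AB1 : 0 < 1 + A * B by rewrite ltr_pwDl.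
have lnAB : 0 <= ln (1 + A * B) by rewrite ln_ge0 // lerDl.
exists (ln (1 + A * B) + `|ln p|); split.
- by rewrite addr_ge0.
- apply: (@le_trans _ _ (expR (ln (1 + A * B)))).
    by rewrite lnK ?posrE // lerDr.
  by rewrite ler_expR lerDl.
- move=> s /pv; apply: le_trans; rewrite -[leRHS]lnK ?posrE // ler_expR.
  by rewrite lerNl (le_trans (ler_norm _)) // normrN lerDr.
Qed.

Lemma value_le_expR C N (U : {set word I J K N}) : A * B <= expR C ->
  value SS vv U <= expR (C * N%:R).
Proof.
move=> hC; apply: le_trans (value_le_exp vv_ge0 U (ltW B0) vv_le) _.
rewrite [C * _]mulrC expRM_natl lerXn2r ?nnegrE ?expR_ge0 //.
by rewrite mulr_ge0 // ltW.
Qed.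

Lemma ln_value_le C N (U : {set word I J K N}) : A * B <= expR C ->
  0 < value SS vv U -> ln (value SS vv U) <= C * N%:R.
Proof.
by move=> hC U0; rewrite -[leRHS]expRK ler_ln ?posrE ?expR_gt0 // value_le_expR.
Qed.

(** * Rounded distributions and convergence of their values *)

Definition rounded (P : L -> R) (r : nat -> L -> nat) : Prop :=
  forall N, (0 < N)%N -> (\sum_(s in S) r N s)%N = N /\
    forall s, s \in S ->
      Num.floor (N%:R * P s) <= (r N s)%:Z <= Num.ceil (N%:R * P s).

Lemma rounded_bounds P r N s : rounded P r -> (0 < N)%N -> s \in S ->
  N%:R * P s - 1 <= (r N s)%:R <= N%:R * P s + 1.
Proof.
move=> hr N0 Ss; have [_ /(_ s Ss)/andP[lo hi]] := hr N N0.
rewrite -(ler_int R) in lo; rewrite -(ler_int R) in hi.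
apply/andP; split.
  have := floorD1_gt (N%:R * P s); rewrite intrD => h.
  by rewrite lerBlDr; apply: le_trans (ltW h) _; rewrite lerD2r.
apply: le_trans hi _; have := ceilB1_lt (N%:R * P s); rewrite intrB => h.
by rewrite -lerBlDr ltW.
Qed.

(** The ceiling of 0 is 0, so rounding never introduces a constituent of probability 0. *)
Lemma rounded_eq0 P r N s : rounded P r -> (0 < N)%N -> s \in S ->
  P s = 0 -> r N s = 0%N.
Proof.
move=> hr N0 Ss Ps; have [_ /(_ s Ss)/andP[_]] := hr N N0.
by rewrite Ps mulr0 ceil0 lez_nat leqn0 => /eqP.
Qed.

(** The comparison behind both convergence and optimality: [q] copies of a type [c] close to [P] fit
    below [r M], and the few remaining positions are filled with diagonal letters. The tolerance
    [delta] is fixed before [n] and [c]. *)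
Lemma mv_scale_up P r C eta : (forall s, s \in S -> 0 <= P s) -> rounded P r ->
  0 <= C -> (forall s, s \in S -> 0 < P s -> expR (- C) <= v s ^+ 3) ->
  0 < eta -> exists2 delta : R, 0 < delta & forall n c l, (0 < n)%N ->
    (forall s, s \in S -> P s = 0 -> c s = 0%N) ->
    (\sum_(s in S) c s)%N = n ->
    (forall s, s \in S -> (c s)%:R <= n%:R * P s + delta * n%:R) ->
    0 < mv n c -> l <= C -> n%:R * l <= ln (mv n c) ->
    exists M0, forall M, (M0 <= M)%N ->
      0 < mv M (r M) /\ M%:R * (l - eta) <= ln (mv M (r M)).
Proof.
move=> P0 hr C0 vP eta0.
have [|p p_gt0 pP] := @fin_pos_min _ _ [pred s in S | 0 < P s] P.
  by move=> s /andP[].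
have C1 : 0 < 2 * C + 1 by rewrite ltr_wpDl // mulr_ge0.
(* Each position not covered by copies of [c] costs at most [2 * C]: [C] for the diagonal letter put
   there and [C] because [l <= C]. *)
have [delta delta0 hq] := quotient_choice p_gt0 (divr_gt0 eta0 C1).
exists delta => // n c l n0 c0 sum_c c_le mv0 lC l_le.
have [M0 hM0] := hq n n0; exists (maxn 1 M0) => M; rewrite geq_max => /andP[M1 MM].
have [q [qn_le loss q_le]] := hM0 M MM.
have [sum_r _] := hr M M1.
pose d := (M - q * n)%N; have Md : (q * n + d)%N = M by rewrite subnKC.
(* Where [P s > 0], the bound [p <= P s] turns the additive error [delta] into the factor
   [1 + delta / p] and the rounding error 1 into at most [P s / p]. *)
have qc s : s \in S -> (q * c s <= r M s)%N.
  move=> Ss; have /orP[/eqP Ps|Ps] : (P s == 0) || (0 < P s).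
    by rewrite eq_sym -le_eqVlt P0.
    by rewrite c0 // muln0.
  rewrite -(ler_nat R) natrM; have /andP[+ _] := rounded_bounds hr M1 Ss.
  apply: le_trans; have pPs : p <= P s by apply: pP; rewrite /= Ss.
  apply: (@le_trans _ _ (q%:R * (n%:R * P s + delta * n%:R))).
    by rewrite ler_wpM2l ?c_le.
  have h1 : delta <= delta / p * P s.
    by rewrite mulrAC ler_pdivlMr // ler_pM2l.
  have h2 : 1 <= P s / p by rewrite ler_pdivlMr // mul1r.
  apply: (@le_trans _ _ (P s * (M%:R - p^-1))); last first.
    by rewrite mulrBr [P s * _]mulrC lerD2l lerN2.
  apply: le_trans (ler_wpM2l (P0 s Ss) q_le).
  have -> : P s * (q%:R * n%:R * (1 + delta / p)) =
     q%:R * (n%:R * P s + (delta / p * P s) * n%:R) by ring.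
  by rewrite ler_wpM2l // lerD2l ler_wpM2r.
have low : mv n c ^+ q * expR (- C) ^+ d <= mv M (r M).
  rewrite -Md.
  have := @mval_extend _ _ _ _ _ S v v_ge0 p1 p2 p3 diag (expR (- C)) d (q * n)
    (fun s => q * c s)%N (r (q * n + d)%N) (expR_ge0 _).
  rewrite Md => ext; apply: le_trans (ext qc _ _).
  - by rewrite ler_wpM2r ?exprn_ge0 ?expR_ge0 // mval_exp.
  - move=> s Ss rs; apply: vP => //; rewrite lt_neqAle P0 // andbT eq_sym.
    by apply: contraTneq rs => Ps; rewrite (rounded_eq0 hr).
  - by rewrite -big_distrr /= sum_c sum_r Md.
have low0 : 0 < mv n c ^+ q * expR (- C) ^+ d.
  by rewrite mulr_gt0 ?exprn_gt0 ?expR_gt0.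
have mvM : 0 < mv M (r M) by apply: lt_le_trans low.
split=> //; have : ln (mv n c ^+ q * expR (- C) ^+ d) <= ln (mv M (r M)).
  by rewrite ler_ln.
apply: le_trans; rewrite lnM ?posrE ?exprn_gt0 ?expR_gt0 // !lnXn ?expR_gt0 // expRK.
rewrite -[ln _ *+ q]mulr_natr -[- C *+ d]mulr_natr.
have dE : d%:R = M%:R - q%:R * n%:R :> R by rewrite -Md natrD natrM; ring.
rewrite natrM -dE in loss.
have h1 : q%:R * (n%:R * l) <= q%:R * ln (mv n c) by rewrite ler_wpM2l.
have h2 : d%:R * (2 * C + 1) <= eta * M%:R.
  by rewrite -ler_pdivlMr // mulrAC.
have h3 : d%:R * l <= d%:R * C by rewrite ler_wpM2l.
have -> : M%:R * (l - eta) = (q%:R * n%:R) * l + d%:R * l - eta * M%:R.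
  by rewrite dE; ring.
have d0 : 0 <= d%:R :> R by [].
by nra.
Qed.


(** The whole type is built from diagonal letters, starting with the empty word. *)
Lemma mv_ge_expR P r C N : (forall s, s \in S -> 0 <= P s) -> rounded P r ->
  (forall s, s \in S -> 0 < P s -> expR (- C) <= v s ^+ 3) ->
  (0 < N)%N -> expR (- C) ^+ N <= mv N (r N).
Proof.
move=> P0 hr vP N0; have [sum_r _] := hr N N0.
have := @mval_extend _ _ _ _ _ S v v_ge0 p1 p2 p3 diag (expR (- C)) N 0
    (fun=> 0%N) (r N) (expR_ge0 _) (fun _ _ => leq0n _).
rewrite sum_r big1 // => ext; apply: le_trans (ext _ (erefl _)).
  rewrite -[leLHS]mul1r ler_wpM2r ?exprn_ge0 ?expR_ge0 //.
  by have := mval_exp v_ge0 p1 p2 p3 0 (fun=> 0%N) 0; rewrite expr0 mul0n.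
move=> s Ss rs; apply: vP => //; rewrite lt_neqAle P0 // andbT eq_sym.
by apply: contraTneq rs => Ps; rewrite (rounded_eq0 hr).
Qed.

(** [mv_scale_up] with [c = r n] supplies the hypothesis of the approximate Fekete lemma. *)
Lemma mv_rate P r : (forall s, s \in S -> 0 <= P s) ->
  rounded P r -> (forall s, 0 < P s -> 0 < v s) ->
  (forall N, (0 < N)%N -> 0 < mv N (r N)) /\
  exists l, rate (fun N => ln (mv N (r N))) l.
Proof.
move=> P0 hr Pv.
have [C [C0 hC hv]] := @bounding_constant [pred s | 0 < P s] Pv.
have vP s : s \in S -> 0 < P s -> expR (- C) <= v s ^+ 3 by move=> _; apply: hv.
have mvN N : (0 < N)%N -> expR (- C) ^+ N <= mv N (r N).
  exact: mv_ge_expR P0 hr vP.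
have eC0 N : 0 < expR (- C) ^+ N by rewrite exprn_gt0 ?expR_gt0.
have mv0 N : (0 < N)%N -> 0 < mv N (r N) by move=> /mvN; apply: lt_le_trans.
have mv_bnd n : (0 < n)%N -> - (C * n%:R) <= ln (mv n (r n)) <= C * n%:R.
  move=> n0; rewrite (ln_value_le hC) ?mv0 // andbT.
  have : ln (expR (- C) ^+ n) <= ln (mv n (r n)) by rewrite ler_ln ?posrE ?mvN ?mv0.
  by rewrite lnXn ?expR_gt0 // expRK -[leLHS]mulr_natr mulNr.
split=> //; apply: (@rate_exists _ _ C) => // eta eta0.
have [delta delta0 hd] := mv_scale_up P0 hr C0 vP eta0.
(* From here on [delta * n] is at least the rounding error 1. *)
exists (Num.trunc delta^-1).+1 => n nd n0.
have [sum_r _] := hr n n0.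
have nR : 0 < n%:R :> R by rewrite ltr0n.
have /andP[_ ub] := mv_bnd n n0.
have [||||||M0 hM0] := hd n (r n) (ln (mv n (r n)) / n%:R) n0.
- by move=> s Ss; apply: rounded_eq0 hr n0 Ss.
- by [].
- move=> s Ss; have /andP[_ h] := rounded_bounds hr n0 Ss.
  apply: le_trans h _; rewrite lerD2l -ler_pdivrMl // mulr1.
  by apply: le_trans (ltW (truncnS_gt _)) _; rewrite ler_nat.
- exact: mv0.
- by rewrite ler_pdivrMr.
- by rewrite mulrC divfK ?gt_eqF.
by exists M0 => M /hM0[].
Qed.

(** [tot] is supermultiplicative, and repeating the diagonal letter at [s0] bounds it from below
    exponentially, so Fekete's argument applies. *)
Lemma tot_rate s0 C : s0 \in S -> 0 <= C -> A * B <= expR C ->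
  expR (- C) <= v s0 ^+ 3 ->
  [/\ forall N, 0 < tot N, exists l, rate (fun N => ln (tot N)) l &
      forall l, rate (fun N => ln (tot N)) l -> - C <= l <= C].
Proof.
move=> S0 C0 hC vC.
have tot_ge N : expR (- C) ^+ N <= tot N.
  apply: (@le_trans _ _ (mv 1 (fun t => s0 == t) ^+ N)).
    rewrite lerXn2r ?nnegrE ?expR_ge0 ?mval_ge0 // (le_trans vC) //.
    exact: (@mval1_ge _ _ _ _ _ S v v_ge0 p1 p2 p3 diag s0 S0).
  apply: le_trans (mval_exp v_ge0 _ _ _ _ _ _) _; rewrite muln1.
  by apply: le_value => // w _ _; rewrite inE.
have tot0 N : 0 < tot N.
  by apply: lt_le_trans (tot_ge N); rewrite exprn_gt0 ?expR_gt0.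
have tot_mul N M : tot N * tot M <= tot (N + M).
  by apply: value_mul => // w w' _ _; rewrite inE.
have tot_exp N q : tot N ^+ q <= tot (q * N).
  elim: q => [|q IHq]; first by have := tot_ge 0%N; rewrite expr0 mul0n.
  rewrite exprS mulSn; apply: le_trans (tot_mul _ _).
  by rewrite ler_wpM2l // ltW.
have bnd n : - (C * n%:R) <= ln (tot n) <= C * n%:R.
  rewrite (ln_value_le hC) ?tot0 // andbT.
  have : ln (expR (- C) ^+ n) <= ln (tot n) by rewrite ler_ln ?posrE ?exprn_gt0 ?expR_gt0.
  by rewrite lnXn ?expR_gt0 // expRK -[leLHS]mulr_natr mulNr.
split=> //; last first.
  move=> l hl; apply/andP; split.
    apply: rate_le (rate_mull _) hl; exists 0%N => n _.
    by have /andP[+ _] := bnd n; rewrite mulrN mulrC.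
  apply: rate_le hl (rate_mull _); exists 0%N => n _.
  by have /andP[_ +] := bnd n; rewrite mulrC.
apply: (@rate_exists _ _ C) => // eta eta0; exists 0%N => n _ n0.
(* Past this bound the remainder of [M] modulo [n], which costs at most [2 * C * n], is
   negligible. *)
exists (Num.trunc (2 * C * n%:R / eta)).+1 => M MM.
have nR : 0 < n%:R :> R by rewrite ltr0n.
have MR : 2 * C * n%:R <= eta * M%:R.
  rewrite [leRHS]mulrC -ler_pdivrMr //.
  by apply: le_trans (ltW (truncnS_gt _)) _; rewrite ler_nat.
pose q := (M %/ n)%N; pose d := (M %% n)%N.
have dn : d%:R <= n%:R :> R by rewrite ler_nat ltnW // ltn_mod.
have ME : M = (q * n + d)%N by apply: divn_eq.
have : ln (tot n ^+ q * tot d) <= ln (tot M).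
  rewrite ler_ln ?posrE ?mulr_gt0 ?exprn_gt0 // ME.
  by apply: le_trans (tot_mul _ _); rewrite ler_wpM2r // ltW.
rewrite lnM ?posrE ?exprn_gt0 // lnXn // => h; apply: le_trans h.
rewrite -[ln _ *+ q]mulr_natr.
have /andP[hd _] := bnd d; have /andP[_ hn] := bnd n.
have ratio : ln (tot n) / n%:R <= C by rewrite ler_pdivrMr.
have tE : ln (tot n) = ln (tot n) / n%:R * n%:R by rewrite divfK ?gt_eqF.
move: ratio tE; set x := ln (tot n) / n%:R => ratio ->.
have MER : M%:R = q%:R * n%:R + d%:R :> R by rewrite ME natrD natrM.
have d0 : 0 <= d%:R :> R by [].
have h1 : d%:R * x <= d%:R * C by rewrite ler_wpM2l.
have h2 : d%:R * C <= n%:R * C by rewrite ler_wpM2r.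
by rewrite mulrBr [M%:R * eta]mulrC {1}MER mulrDl; lra.
Qed.


(** * Averaged marginals of a limit type *)

Definition occ (s : L) (a : I * J * K) : nat :=
  ((p1 a == s) + (p2 a == s) + (p3 a == s))%N.

Lemma sum_occ a : a \in SS -> (\sum_(s in S) occ s a)%N = 3.
Proof.
rewrite inE => /and3P[S1 S2 S3].
have sum1 t : t \in S -> (\sum_(s in S) (t == s))%N = 1%N.
  move=> St; rewrite (bigD1 t) //= eqxx big1 // => s /andP[_].
  by rewrite eq_sym => /negPf->.
by rewrite !big_split /= !sum1.
Qed.

Lemma occ_gt0 s a : a \in SS -> (0 < occ s a)%N -> s \in S.
Proof.
rewrite inE => /and3P[S1 S2 S3]; rewrite /occ.
by case: eqP => [<-|_] //; case: eqP => [<-|_] //; case: eqP => [<-|_].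
Qed.

Lemma marginals_occ (k : I * J * K -> nat) s :
  (\sum_(a | p1 a == s) k a + \sum_(a | p2 a == s) k a +
   \sum_(a | p3 a == s) k a)%N = (\sum_a k a * occ s a)%N.
Proof.
rewrite ![(\sum_(a | _) _)%N]big_mkcond -!big_split /=; apply: eq_bigr => a _.
by rewrite /occ; do 3 case: eqP => _; rewrite /= ?muln0 ?muln1 //; lia.
Qed.

Section LimitType.
Variable Q : I * J * K -> R.
Hypothesis Q_ge0 : forall a, 0 <= Q a.
Hypothesis Q_supp : forall a, 0 < Q a -> a \in SS /\ 0 < vv a.
Hypothesis sum_Q : \sum_a Q a = 1.

(** The mean of the three marginals of [Q]: [occ] counts over all three factors, whence the division
    by 3. *)
Definition average_marginal (s : L) : R := (\sum_a Q a * (occ s a)%:R) / 3.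
Let P := average_marginal.

Lemma average_marginal_ge0 s : 0 <= P s.
Proof. by rewrite divr_ge0 // sumr_ge0 // => a _; rewrite mulr_ge0. Qed.

Lemma average_marginal_gt0 s : 0 < P s ->
  exists a, [/\ 0 < Q a, (0 < occ s a)%N & a \in SS].
Proof.
move=> Ps; apply: contrapT => no_a; move: Ps; rewrite /P /average_marginal.
rewrite big1 ?mul0r ?ltxx // => a _.
have /orP[/eqP->|Qa] : (Q a == 0) || (0 < Q a) by rewrite eq_sym -le_eqVlt.
  by rewrite mul0r.
have [->|oa] := posnP (occ s a); first by rewrite mulr0.
by case: no_a; exists a; have [] := Q_supp Qa.
Qed.

Lemma average_marginal_out s : s \notin S -> P s = 0.
Proof.
move=> Ss; apply/eqP; rewrite eq_le average_marginal_ge0 andbT leNgt.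
by apply: contra Ss => /average_marginal_gt0[a [_ oa Sa]]; apply: occ_gt0 oa.
Qed.

(** A letter charged by [Q] has only factors charged by [P]; so a type supported in the support of
    [Q] has its marginals in the support of [P]. *)
Lemma average_marginal_eq0 s a : P s = 0 -> 0 < Q a -> occ s a = 0%N.
Proof.
move=> Ps Qa; apply/eqP; apply: contraT; rewrite -lt0n => oa.
suff : 0 < P s by rewrite Ps ltxx.
rewrite /P /average_marginal (bigD1 a) //= divr_gt0 // ltr_pwDl //.
  by rewrite mulr_gt0 // ltr0n.
by rewrite sumr_ge0 // => b _; rewrite mulr_ge0.
Qed.

(** Such an [s] is a factor of a letter charged by [Q], and a product of positive value has no
    factor of value 0. *)
Lemma average_marginal_vpos s : 0 < P s -> 0 < v s.
Proof.
move=> /average_marginal_gt0[a [Qa oa Sa]]; have [_ va] := Q_supp Qa.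
have Ss := occ_gt0 Sa oa; rewrite lt_neqAle v_ge0 // andbT eq_sym.
apply: contraTneq va => v0; move: oa; rewrite /occ /vv /triv -leNgt.
case: eqP => [->|_]; first by rewrite v0 !mul0r.
case: eqP => [->|_]; first by rewrite v0 mulr0 mul0r.
by case: eqP => [->|_] //; rewrite v0 mulr0.
Qed.

Lemma average_marginal_sum : \sum_(s in S) P s = 1.
Proof.
rewrite -mulr_suml exchange_big /=.
rewrite (eq_bigr (fun a => Q a * 3)) => [|a _].
  by rewrite -mulr_suml sum_Q mul1r divff.
rewrite -mulr_sumr -natr_sum.
have /orP[/eqP->|Qa] : (Q a == 0) || (0 < Q a) by rewrite eq_sym -le_eqVlt.
  by rewrite !mul0r.
by rewrite sum_occ //; have [] := Q_supp Qa.
Qed.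

Lemma average_marginal_le1 s : P s <= 1.
Proof.
have [Ss|/average_marginal_out->//] := boolP (s \in S).
rewrite -average_marginal_sum (bigD1 s) //= lerDl sumr_ge0 // => t _.
exact: average_marginal_ge0.
Qed.

Hypothesis k_types : forall delta : R, 0 < delta -> forall N0 : nat,
  exists N (k : I * J * K -> nat), [/\ (N0 <= N)%N,
    tot N <= N.+1%:R ^+ #|{: I * J * K}| * value SS vv (jtype N k) &
    forall a, `|(k a)%:R - N%:R * Q a| <= delta * N%:R].

(* Letters outside the support of the limit type Q have density o(1) in the
   types k_N; deleting them costs a subexponential factor and makes the
   averaged marginals supported in supp P. *)
Lemma tot_rate_le r C l l' : rounded P r ->
  0 <= C -> A * B <= expR C ->
  (forall s, s \in S -> 0 < P s -> expR (- C) <= v s ^+ 3) ->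
  (forall N, 0 < tot N) -> - C <= l <= C ->
  rate (fun N => ln (tot N)) l -> rate (fun N => ln (mv N (r N))) l' -> l <= l'.
Proof.
move=> hr C0 hC vP tot0 /andP[lC1 lC2] tot_l mv_l'.
(* Loss budget: [3 * eta] for the rate of [tot], the number of types and the deletions,
   [2 * (C + 3) * eta] for the shortened length, and [eta] for scaling up. *)
apply: (@le_of_small_loss _ _ _ (10 + 2 * C)) => [|eta /andP[eta0 eta1]].
  by rewrite addr_ge0 // mulr_ge0.
have [d1 d1_gt0 key] := mv_scale_up (fun s _ => average_marginal_ge0 s) hr C0 vP eta0.
have [d2 d2_gt0 bin_le] := ln_bin_sublinear (ln (A * B)) eta0.
have [N1 hN1] := ln_natS_sublinear A0 eta0.
have [N2 hN2] := tot_l _ eta0.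
pose A1 := 4 * A + 1.
have A1_gt0 : 0 < A1 by rewrite ltr_wpDl // mulr_ge0.
(* [d0] secures at once the tolerance of the scaling, the binomial bound, a length loss of at most
   [eta] and the survival of half of the positions; [delta] is smaller by [4 * A + 1] so that errors
   can be summed over all letters. *)
pose d0 := Num.min (Num.min d1 d2) (Num.min eta 2^-1).
have d0_gt0 : 0 < d0 by rewrite !lt_min d1_gt0 d2_gt0 eta0 invr_gt0 ltr0n.
pose delta := d0 / A1; have delta_gt0 : 0 < delta by rewrite divr_gt0.
have d0E : delta * A1 = d0 by rewrite divfK ?gt_eqF.
have [d0d1 d0d2 d0eta d0half] : [/\ d0 <= d1, d0 <= d2, d0 <= eta & d0 <= 2^-1].
  by rewrite /d0 !ge_min !lexx !orbT.
have A_delta : 0 <= A * delta by rewrite mulr_ge0 // ltW.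
have A_delta_le : 4 * (A * delta) <= d0.
  by rewrite -d0E /A1 mulrDr mulr1; nra.
have [N [k [N_ge tot_le k_near]]] := k_types delta_gt0 (maxn 1 (maxn N1 N2)).
move: N_ge; rewrite !geq_max => /and3P[N_gt0 /hN1 lnN /hN2/andP[lnT _]].
have NR : 0 < N%:R :> R by rewrite ltr0n.
set Mk := value SS vv (jtype N k) in tot_le.
have lnN_ge0 : 0 < N.+1%:R ^+ #|{: I * J * K}| :> R by rewrite exprn_gt0.
have Mk_gt0 : 0 < Mk.
  by rewrite -(pmulr_rgt0 _ lnN_ge0); apply: lt_le_trans tot_le.
have lnMk : ln (tot N) <= eta * N%:R + ln Mk.
  have : ln (tot N) <= ln (N.+1%:R ^+ #|{: I * J * K}| * Mk).
    by rewrite ler_ln ?posrE ?mulr_gt0.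
  move=> /le_trans; apply; rewrite lnM ?posrE // lnXn // lerD2r.
  by rewrite -[leLHS]mulr_natl.
have [sum_k k_supp] := jtype_gt0 vv_ge0 Mk_gt0.
(* Delete the letters outside the support of [Q]; each of them occurs at most [delta * N] times. *)
pose k' a := if 0 < Q a then k a else 0%N.
have k'_le a : (k' a <= k a)%N by rewrite /k'; case: ifP.
pose n' := (\sum_a k' a)%N; pose d := (\sum_a (k a - k' a))%N.
have Nnd : N = (n' + d)%N.
  rewrite -sum_k -big_split /=; apply: eq_bigr => a _.
  by rewrite subnKC.
have kd a : (k a - k' a)%:R <= delta * N%:R.
  rewrite /k'; case: ifPn => [_|]; first by rewrite subnn mulr_ge0 // ltW.
  rewrite -leNgt => Qa; have {Qa}Qa : Q a = 0 by apply/le_anti; rewrite Qa Q_ge0.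
  have := k_near a; rewrite Qa mulr0 subr0 subn0; apply: le_trans.
  exact: ler_norm.
have d_le : d%:R <= A * delta * N%:R.
  rewrite /d natr_sum; apply: (@le_trans _ _ (\sum_(a : I * J * K) delta * N%:R)).
    by apply: ler_sum => a _; apply: kd.
  by rewrite sumr_const -[leLHS]mulr_natl mulrA.
have NRE : N%:R = n'%:R + d%:R :> R by rewrite {1}Nnd natrD.
have d_half : d%:R <= 2^-1 * N%:R :> R.
  by apply: le_trans d_le _; rewrite ler_pM2r //; lra.
have n'N : N%:R <= 2 * n'%:R :> R by lra.
have n'_gt0 : (0 < n')%N by rewrite -(ltr0n R); lra.
set Mk' := value SS vv (jtype n' k').
have Mk_le : Mk <= 'C(N, d)%:R * (A * B) ^+ d * Mk'.
  rewrite /Mk /Mk' Nnd; apply: value_jtype_sub => //; first exact: ltW.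
  by rewrite -Nnd.
have Mk'_ge0 : 0 <= Mk' by apply: value_ge0.
have AB_ge0 : 0 <= A * B by rewrite mulr_ge0 // ltW.
have bin_gt0R : 0 < 'C(N, d)%:R :> R by rewrite ltr0n bin_gt0 Nnd leq_addl.
have prod_gt0 : 0 < 'C(N, d)%:R * (A * B) ^+ d * Mk' by apply: lt_le_trans Mk_le.
have ABd_gt0 : 0 < (A * B) ^+ d.
  rewrite lt_neqAle exprn_ge0 // andbT; apply: contraTneq prod_gt0 => <-.
  by rewrite mulr0 mul0r ltxx.
have Mk'_gt0 : 0 < Mk'.
  by rewrite -(pmulr_rgt0 _ (mulr_gt0 bin_gt0R ABd_gt0)).
(* Needed for the logarithm: the alphabet is nonempty because a word of positive length exists. *)
have AB_gt0 : 0 < A * B.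
  have [w _ _] := value_gt0P vv_ge0 Mk_gt0.
  by rewrite mulr_gt0 // ltr0n; apply/card_gt0P; exists (letter w (Ordinal N_gt0)).
have lnMk' : ln Mk <= eta * N%:R + ln Mk'.
  have : ln Mk <= ln ('C(N, d)%:R * (A * B) ^+ d * Mk') by rewrite ler_ln.
  move=> /le_trans; apply; rewrite !lnM ?posrE ?mulr_gt0 // lerD2r.
  rewrite lnXn // -[X in _ + X]mulr_natl; apply: bin_le.
    by rewrite Nnd leq_addl.
  by apply: le_trans d_le _; rewrite ler_pM2r //; lra.
(* The common marginal, of total [3 * n'], after multiplication with the two rotations. *)
pose c s := (\sum_a k' a * occ s a)%N.
have mv_c : Mk' ^+ 3 <= mv (n' + n' + n') c.
  apply: le_trans (_ : _ <= mval S v p1 p2 p3 n'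
     (fun s => \sum_(a | p1 a == s) k' a)%N
     (fun s => \sum_(a | p2 a == s) k' a)%N
     (fun s => \sum_(a | p3 a == s) k' a)%N ^+ 3) _.
    by rewrite lerXn2r ?nnegrE ?mval_ge0 // mval_jtype.
  apply: le_trans (mval_symmetrize v_ge0 hI_inj hJ_inj hK_inj p1_cyc p2_cyc p3_cyc _ _ _ _) _.
  by rewrite (eq_mval c c c) // => s _; apply: marginals_occ.
set n := (n' + n' + n')%N in mv_c.
have nRE : n%:R = 3 * n'%:R :> R by rewrite /n !natrD; ring.
have mv_gt0 : 0 < mv n c by apply: lt_le_trans mv_c; rewrite exprn_gt0.
have k'_supp a : (0 < k' a)%N -> 0 < Q a by rewrite /k'; case: ifP.
have c_null s : s \in S -> P s = 0 -> c s = 0%N.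
  move=> _ Ps; rewrite /c big1 // => a _.
  have [->//|/k'_supp Qa] := posnP (k' a).
  by rewrite (average_marginal_eq0 Ps Qa) muln0.
have sum_c : (\sum_(s in S) c s)%N = n.
  rewrite exchange_big /= (eq_bigr (fun a => k' a * 3)%N) => [|a _].
    by rewrite -big_distrl /= -/n' /n !mulnS muln0 addn0 addnA.
  rewrite -big_distrr /=; have [->//|/k'_supp Qa] := posnP (k' a).
  by rewrite sum_occ //; have [] := Q_supp Qa.
(* [c s] exceeds [3 * N * P s] by at most [3 * A * delta * N]. Passing from [3 * N] to [n = 3 * n']
   costs at most as much again, and [N <= 2 * n'] bounds the total by [4 * A * delta * n]. *)
have c_le s : s \in S -> (c s)%:R <= n%:R * P s + d1 * n%:R.
  move=> Ss; have h1 : (c s)%:R <= 3 * (N%:R * P s) + 3 * (A * delta * N%:R).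
    have -> : 3 * (N%:R * P s) = \sum_a N%:R * Q a * (occ s a)%:R.
      rewrite /P /average_marginal mulrCA [3 * _]mulrC divfK // mulr_sumr.
      by apply: eq_bigr => a _; rewrite mulrA.
    have -> : 3 * (A * delta * N%:R) = \sum_(a : I * J * K) 3 * (delta * N%:R).
      by rewrite sumr_const -[RHS]mulr_natl; rewrite -/A; ring.
    rewrite -big_split /c natr_sum /=; apply: ler_sum => a _.
    have occ3 : (occ s a)%:R <= 3 :> R.
      by rewrite ler_nat /occ; do 3 case: eqP.
    rewrite natrM; apply: (@le_trans _ _ ((N%:R * Q a + delta * N%:R) * (occ s a)%:R)).
      rewrite ler_wpM2r // /k'; case: ifP => [_|_]; last first.
        by rewrite addr_ge0 // mulr_ge0 // ltW.
      by rewrite -lerBlDl; apply: le_trans (k_near a); apply: ler_norm.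
    rewrite mulrDl lerD2l mulrC ler_wpM2r // mulr_ge0 // ltW //.
  have P1 := average_marginal_le1 s; have P0 := average_marginal_ge0 s.
  have h2 : d%:R * P s <= A * delta * N%:R.
    by apply: le_trans d_le; rewrite ler_piMr.
  have h3 : A * delta * N%:R <= A * delta * (2 * n'%:R) by rewrite ler_wpM2l.
  have h4 : 4 * (A * delta) * n%:R <= d1 * n%:R.
    by rewrite ler_wpM2r //; lra.
  have h5 : N%:R * P s = n'%:R * P s + d%:R * P s by rewrite NRE mulrDl.
  rewrite nRE in h4 *; rewrite h5 in h1.
  by lra.
have [|||||||M0 hM0] := key n c (l - (9 + 2 * C) * eta).
- by rewrite /n addn_gt0 n'_gt0 orbT.
- exact: c_null.
- exact: sum_c.
- exact: c_le.
- exact: mv_gt0.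
- have : 0 <= (9 + 2 * C) * eta by rewrite mulr_ge0 ?addr_ge0 ?mulr_ge0 // ltW.
  by lra.
- apply: (@le_trans _ _ (ln (Mk' ^+ 3))); last by rewrite ler_ln ?posrE ?exprn_gt0.
  rewrite lnXn // -[leRHS]mulr_natl nRE.
  have h1 : N%:R * (l - 3 * eta) <= ln Mk' by lra.
  have d_eta : d%:R <= eta * (2 * n'%:R).
    apply: le_trans d_le _; apply: le_trans (_ : eta * N%:R <= _).
      by rewrite ler_pM2r //; lra.
    by rewrite ler_pM2l.
  have h2 : d%:R * (- (C + 3 * eta)) <= d%:R * (l - 3 * eta).
    by rewrite ler_wpM2l //; lra.
  have h3 : d%:R * (C + 3 * eta) <= eta * (2 * n'%:R) * (C + 3).
    by rewrite ler_pM // ?addr_ge0 ?mulr_ge0 //; lra.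
  rewrite NRE in h1.
  by lra.
rewrite -[leLHS]/(l - _); have -> : l - (10 + 2 * C) * eta = l - (9 + 2 * C) * eta - eta by ring.
apply: rate_le (rate_mull _) mv_l'; exists M0 => M /hM0[_]; exact.
Qed.

End LimitType.

(** For each [N] some joint type carries [tot N] up to a polynomial factor; [Q] is a cluster point
    of the letter frequencies of these types. *)
Lemma exists_limit_type : (forall N, 0 < tot N) ->
  exists Q : I * J * K -> R, [/\ forall a, 0 <= Q a,
    forall a, 0 < Q a -> a \in SS /\ 0 < vv a, \sum_a Q a = 1 &
    forall delta : R, 0 < delta -> forall N0 : nat,
    exists N (k : I * J * K -> nat), [/\ (N0 <= N)%N,
      tot N <= N.+1%:R ^+ #|{: I * J * K}| * value SS vv (jtype N k) &
      forall a, `|(k a)%:R - N%:R * Q a| <= delta * N%:R]].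
Proof.
move=> tot0.
have /choice[k k_le] := fun N => value_le_jtype vv_ge0 [set: word I J K N]%SET.
have k0 N : 0 < value SS vv (jtype N (k N)).
  have c0 : 0 < N.+1%:R ^+ #|{: I * J * K}| :> R by rewrite exprn_gt0.
  by rewrite -(pmulr_rgt0 _ c0); apply: lt_le_trans (k_le N); apply: tot0.
pose f N a : R := (k N a)%:R / N%:R.
have f01 N a : 0 <= f N a <= 1.
  rewrite divr_ge0 //=; have [sum_k _] := jtype_gt0 vv_ge0 (k0 N).
  (* At [N = 0] the inverse of zero is zero, so [f] vanishes. *)
  case: N sum_k => [|N] sum_k; first by rewrite /f invr0 mulr0.
  rewrite ler_pdivrMr ?ltr0n // mul1r ler_nat -{2}sum_k.
  by rewrite (bigD1 a) //= leq_addr.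
have [Q hQ] := cluster_seq f01.
exists Q; split.
- move=> a; apply/ler_addgt0Pr => e e0; have [N _ /(_ a)] := hQ e e0 0%N.
  have /andP[f0 _] := f01 N a; rewrite ltr_norml => /andP[_].
  by rewrite ltrBlDr addrC => /ltW; apply: le_trans.
(* With tolerance [Q a] the frequency of [a] is positive, so [a] occurs in a type of positive
   value. *)
- move=> a Qa; have [N _ /(_ a)] := hQ _ Qa 0%N.
  rewrite ltr_norml ltrBrDr addNr => /andP[fa _].
  have [_] := jtype_gt0 vv_ge0 (k0 N); apply.
  by rewrite lt0n; apply: contraTneq fa => ka; rewrite /f ka mul0r ltxx.
- apply/eqP; rewrite -subr_eq0 -normr_le0; apply/ler_addgt0Pr => e e0.
  rewrite add0r; have A1 : 0 < A + 1 by rewrite ltr_wpDl.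
  have [N N0 near_f] := hQ _ (divr_gt0 e0 A1) 1%N.
  have sum_f : \sum_a f N a = 1.
    have [sum_k _] := jtype_gt0 vv_ge0 (k0 N).
    by rewrite -mulr_suml -natr_sum sum_k divff // pnatr_eq0 -lt0n.
  rewrite -sum_f distrC -sumrB; apply: le_trans (ler_norm_sum _ _ _) _.
  apply: (@le_trans _ _ (\sum_(a : I * J * K) e / (A + 1))).
    by apply: ler_sum => a _; apply: ltW.
  rewrite sumr_const -[leLHS]mulr_natl -/A mulrA ler_pdivrMr // mulrC.
  by rewrite ler_pM2l // lerDl.
- move=> delta delta0 N0; have [N] := hQ _ delta0 (maxn 1 N0).
  rewrite geq_max => /andP[N1 NN] near_f; exists N, (k N); split=> [//||a].
    exact: k_le.
  have NR : 0 < N%:R :> R by rewrite ltr0n.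
  have -> : (k N a)%:R - N%:R * Q a = (f N a - Q a) * N%:R.
    by rewrite /f mulrBl divfK ?gt_eqF // [Q a * _]mulrC.
  by rewrite normrM [`|N%:R|]ger0_norm // ler_pM2r // ltW.
Qed.

Lemma exists_optimal_distribution s0 : s0 \in S -> 0 < v s0 ->
  exists l (P : L -> R), [/\ rate (fun N => ln (tot N)) l,
    forall s, 0 <= P s, forall s, s \notin S -> P s = 0, \sum_(s in S) P s = 1 &
    (forall s, 0 < P s -> 0 < v s) /\
    forall r l', rounded P r -> rate (fun N => ln (mv N (r N))) l' -> l <= l'].
Proof.
move=> S0 v0.
have [|C0 [C0_ge0 hC0 vC0]] := @bounding_constant (pred1 s0); first by move=> s /eqP->.
have [tot0 [l tot_l] _] := tot_rate S0 C0_ge0 hC0 (vC0 s0 (eqxx _)).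
have [Q [Q_ge0 Q_supp sum_Q k_types]] := exists_limit_type tot0.
pose P := average_marginal Q.
have Pv s : 0 < P s -> 0 < v s by apply: average_marginal_vpos Q_ge0 Q_supp s.
(* The constant is chosen anew: it must also bound the values on the support of [P], which became
   available only after [tot] was known to be positive. *)
have [|C [C_ge0 hC vC]] := @bounding_constant [pred s | (s == s0) || (0 < P s)].
  by move=> s /orP[/eqP->|/Pv].
have [_ _ /(_ l tot_l) lC] : [/\ forall N, 0 < tot N,
    exists l, rate (fun N => ln (tot N)) l &
    forall l, rate (fun N => ln (tot N)) l -> - C <= l <= C].
  by apply: tot_rate S0 C_ge0 hC _; apply: vC; rewrite /= eqxx.
exists l, P; split=> //.
- exact: average_marginal_ge0.
- by move=> s; apply: average_marginal_out Q_supp s.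
- exact: average_marginal_sum Q_ge0 Q_supp sum_Q.
split=> // r l' hr mv_l'.
apply: (tot_rate_le Q_ge0 Q_supp sum_Q k_types hr C_ge0 hC _ tot0 lC tot_l mv_l').
by move=> s _ Ps; apply: vC; rewrite /= Ps orbT.
Qed.

Lemma mv_le_tot N c : mv N c <= tot N.
Proof. by apply: le_value => // w _ _; rewrite inE. Qed.

Lemma value_eq0 N (U : {set word I J K N}) : (0 < N)%N ->
  (forall s, s \in S -> v s = 0) -> value SS vv U = 0.
Proof.
move=> N0 v0; apply/eqP; apply: contraT => V0.
have [w _ /(_ (Ordinal N0))[]] : exists2 w, w \in U &
    forall n, letter w n \in SS /\ 0 < vv (letter w n).
  by apply: value_gt0P => //; rewrite lt_neqAle eq_sym V0 value_ge0.
by rewrite inE => /and3P[S1 _ _]; rewrite /vv /triv v0 // !mul0r ltxx.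
Qed.

(** Once [N * P s > 1] the rounded count of [s] is positive, so every word of the type contains a
    letter of value 0. *)
Lemma mv_eventually0 (P : L -> R) r s : rounded P r -> s \in S -> v s = 0 ->
  0 < P s -> exists N0, forall N, (N0 <= N)%N -> mv N (r N) = 0.
Proof.
move=> hr Ss vs Ps; exists (Num.trunc (P s)^-1).+2 => N NN.
have N0 : (0 < N)%N by apply: leq_trans NN.
have rs : (0 < r N s)%N.
  rewrite -(ltr0n R); have /andP[+ _] := rounded_bounds hr N0 Ss.
  apply: lt_le_trans; rewrite subr_gt0 -ltr_pdivrMr // mul1r.
  by apply: lt_le_trans (truncnS_gt _) _; rewrite ler_nat ltnW.
apply/eqP; apply: contraT => V0.
have [w /mtypeP wU vw] : exists2 w, w \in mtype S p1 p2 p3 N (r N) (r N) (r N) &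
    forall n, letter w n \in SS /\ 0 < vv (letter w n).
  by apply: value_gt0P => //; rewrite lt_neqAle eq_sym V0 mval_ge0.
have [pw _ _] := wU s Ss; move: rs; rewrite -pw => /card_gt0P[n].
rewrite inE => /eqP w1; have [_] := vw n.
by rewrite /vv /triv w1 vs !mul0r ltxx.
Qed.

End Asymptotics.

(** * Translation to partitioned tensors *)

Section Supports.
Variable F : fieldType.

Lemma suppP (T : ptensor F) (s : annot T) :
  reflect (exists x y z, [/\ partX x = annX s, partY y = annY s,
             partZ z = annZ s & coef x y z != 0]) (s \in supp T).
Proof.
rewrite inE; apply: (iffP existsP) => [[x /existsP[y /existsP[z nz]]]|].
  exists (val x), (val y), (val z); split; [exact: eqP (valP x) | exact: eqP (valP y) | exact: eqP (valP z) | exact: nz].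
move=> [x [y [z [/eqP xs /eqP ys /eqP zs nz]]]].
exists (Sub x xs); apply/existsP; exists (Sub y ys).
by apply/existsP; exists (Sub z zs).
Qed.

Lemma supp_mul (T T' : ptensor F) (s : annot (ptensor_mul T T')) :
  (s \in supp (ptensor_mul T T')) =
  (annot_fst s \in supp T) && (annot_snd s \in supp T').
Proof.
case: s => [[sx sy] sz].
apply/suppP/andP => [[x [y [z []]]]|[/suppP[x [y [z [xs ys zs nz]]]]]].
  rewrite /annX /annY /annZ /= => <- <- <-; rewrite mulf_eq0 => /norP[nz nz'].
  by split; apply/suppP; [exists x.1, y.1, z.1 | exists x.2, y.2, z.2].
move=> /suppP[x' [y' [z' [xs' ys' zs' nz']]]].
exists (x, x'), (y, y'), (z, z'); split=> /=; last by rewrite mulf_neq0.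
- by rewrite xs xs' [RHS]surjective_pairing.
- by rewrite ys ys' [RHS]surjective_pairing.
- by rewrite zs zs' [RHS]surjective_pairing.
Qed.

(** A coefficient of the power is a product in a field, nonzero exactly when all factors are;
    witnesses are chosen position by position. *)
Lemma supp_exp (T : ptensor F) N (t : annot (ptensor_exp T N)) :
  (t \in supp (ptensor_exp T N)) = [forall n, annot_nth t n \in supp T].
Proof.
apply/suppP/forallP => [[x [y [z [xs ys zs nz]]]] n|ht].
  apply/suppP; exists (x n), (y n), (z n); rewrite /annot_nth -xs -ys -zs.
  by split; rewrite /annX /annY /annZ /= ?ffunE //; apply: (prodf_neq0 _ _ nz).
have /fin_all_exists[x hx] : forall n, exists x, exists y z,
    [/\ partX x = annX t n, partY y = annY t n, partZ z = annZ t n & coef x y z != 0].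
  by move=> n; have /suppP := ht n.
have /fin_all_exists[y hy] : forall n, exists y, exists z,
    [/\ partX (x n) = annX t n, partY y = annY t n, partZ z = annZ t n & coef (x n) y z != 0].
  exact: hx.
have /fin_all_exists[z hz] : forall n, exists z,
    [/\ partX (x n) = annX t n, partY (y n) = annY t n, partZ z = annZ t n & coef (x n) (y n) z != 0].
  exact: hy.
exists [ffun n => x n], [ffun n => y n], [ffun n => z n]; split.
- by apply/ffunP => n; rewrite !ffunE; have [] := hz n.
- by apply/ffunP => n; rewrite !ffunE; have [] := hz n.
- by apply/ffunP => n; rewrite !ffunE; have [] := hz n.
- by apply/prodf_neq0 => n _; rewrite !ffunE; have [] := hz n.
Qed.

Lemma supp_restr (T : ptensor F) A B C (s : annot T) :
  (s \in supp (@ptensor_restr F T A B C)) =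
  (s \in supp T) && [&& annX s \in A, annY s \in B & annZ s \in C].
Proof.
apply/suppP/andP => [[x [y [z [xs ys zs]]]]|[/suppP[x [y [z [xs ys zs nz]]]] sABC]].
  rewrite /=; case: ifP => [sABC nz|_]; last by rewrite eqxx.
  by rewrite -[annX s]xs -[annY s]ys -[annZ s]zs; split=> //; apply/suppP; exists x, y, z.
by exists x, y, z; split=> //=; rewrite xs ys zs sABC.
Qed.

Definition annot_unrot (T : ptensor F) (s : annot (ptensor_rot T)) : annot T :=
  (annZ s, annX s, annY s).

Lemma annot_rotK (T : ptensor F) : cancel (@annot_rot F T) (@annot_unrot T).
Proof. by case=> [[x y] z]. Qed.

Lemma annot_unrotK (T : ptensor F) : cancel (@annot_unrot T) (@annot_rot F T).
Proof. by case=> [[x y] z]. Qed.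

Lemma supp_rot (T : ptensor F) (s : annot (ptensor_rot T)) :
  (s \in supp (ptensor_rot T)) = (annot_unrot s \in supp T).
Proof.
apply/suppP/suppP => [[x [y [z [xs ys zs nz]]]]|[x [y [z [xs ys zs nz]]]]].
  by exists z, x, y.
by exists y, z, x.
Qed.

End Supports.

(** The support of a restriction of the power is [live] of the same kept indices, so both maxima
    range over the same sums. *)
Lemma max_restrE (R : realType) (F : fieldType) (W : vtensor R F) N rho
    (U : {set annot (vtensor_exp W N)}) :
  max_restr rho U = value (supp W) (Val rho) (U : {set word _ _ _ N}).
Proof.
have liveE (D : {set idxX (vtensor_exp W N)} * {set idxY (vtensor_exp W N)} *
      {set idxZ (vtensor_exp W N)}) :
    supp (vtensor_restr D.1.1 D.1.2 D.2) = live (supp W) (D : restriction _ _ _ N).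
  apply/setP => w.
  apply: etrans (@supp_restr F (ptensor_exp W N) D.1.1 D.1.2 D.2 w) _.
  rewrite (@supp_exp F W N w).
  by rewrite /live finset.in_set.
by apply: eq_big => D; rewrite liveE.
Qed.

(** * The product of a tensor with its two rotations *)

Section Rot3.
Variables (R : realType) (F : fieldType) (T : vtensor R F).

(** The three factors are rotated back to annotations of [T], so that their counts can be
    compared. *)
Definition factor1 (a : annot (rot3 T)) : annot T := annot_fst (annot_fst a).
Definition factor2 (a : annot (rot3 T)) : annot T :=
  annot_unrot (annot_snd (annot_fst a)).
Definition factor3 (a : annot (rot3 T)) : annot T :=
  annot_unrot (annot_unrot (annot_snd a)).

Lemma supp_rot3 : supp (rot3 T) = triS (supp T) factor1 factor2 factor3.
Proof. by apply/setP => a; rewrite [LHS]supp_mul supp_mul !supp_rot [RHS]finset.in_set andbA. Qed.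

Lemma VprNE rho N : VprN T rho N =
  value (triS (supp T) factor1 factor2 factor3)
    (triv (Val rho) factor1 factor2 factor3) [set: word _ _ _ N]%SET.
Proof. by rewrite /VprN max_restrE supp_rot3. Qed.

Lemma VprPNE r rho P N : VprPN r rho P N =
  mval (supp T) (@Val R F T rho) factor1 factor2 factor3 N (r N P) (r N P) (r N P).
Proof.
rewrite /VprPN max_restrE supp_rot3; congr value; apply/setP => w.
rewrite [LHS]inE [RHS]inE; apply: eq_forallb_in => s _; congr [&& _, _ & _].
- congr (_ == _); apply: eq_card => n; rewrite !inE.
  by rewrite -(inj_eq (can_inj (@annot_unrotK F T))) annot_rotK.
- congr (_ == _); apply: eq_card => n; rewrite !inE.
  rewrite -(inj_eq (can_inj (@annot_unrotK F _))) annot_rotK.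
  by rewrite -(inj_eq (can_inj (@annot_unrotK F T))) annot_rotK.
Qed.

Lemma factor_diag s : exists a, [/\ factor1 a = s, factor2 a = s & factor3 a = s].
Proof.
case: s => [[x y] z].
by exists ((x, y, z), (y, z, x), (z, x, y)).
Qed.

(** The [x]-, [y]- and [z]-indices of the product are triples over the same three index sets in
    cyclically shifted order; the shifts realize its invariance under rotation. *)
Definition rotX (x : idxX (rot3 T)) : idxY (rot3 T) := (x.1.2, x.2, x.1.1).
Definition rotY (y : idxY (rot3 T)) : idxZ (rot3 T) := (y.1.2, y.2, y.1.1).
Definition rotZ (z : idxZ (rot3 T)) : idxX (rot3 T) := (z.1.2, z.2, z.1.1).

Lemma rotX_inj : injective rotX.
Proof. by move=> [[? ?] ?] [[? ?] ?] [-> -> ->]. Qed.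
Lemma rotY_inj : injective rotY.
Proof. by move=> [[? ?] ?] [[? ?] ?] [-> -> ->]. Qed.
Lemma rotZ_inj : injective rotZ.
Proof. by move=> [[? ?] ?] [[? ?] ?] [-> -> ->]. Qed.

Lemma factor1_cyc a : factor1 (cyc rotX rotY rotZ a) = factor2 a.
Proof. by []. Qed.
Lemma factor2_cyc a : factor2 (cyc rotX rotY rotZ a) = factor3 a.
Proof. by []. Qed.
Lemma factor3_cyc a : factor3 (cyc rotX rotY rotZ a) = factor1 a.
Proof. by []. Qed.

End Rot3.

(** * Convergence of the values and the maximum over distributions *)

Unset Implicit Arguments.

Theorem mainTheorem2 (R : realType) (F : fieldType) (T : vtensor R F)
    (hT : estimated T) (T_neq0 : supp T != finset.set0)
    (r : nat -> {ffun annot T -> R} -> annot T -> nat) (hr : rounding r)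
    (rho : R) (hrho : 2 <= rho <= 3) :
  [/\ cvgn (Vpr_seq T rho),
      forall P, dist T P -> cvgn (VprP_seq r rho P) &
      is_maximum (Vpr T rho) [set VprP r rho P | P in dist T]].
Proof.
pose v : annot T -> R := Val rho.
have v_ge0 s : s \in supp T -> 0 <= v s by move=> Ss; have [] := hT rho s hrho Ss.
have rd P : dist T P -> rounded (supp T) P (fun N => r N P).
  by move=> dP N N0; apply: hr.
pose tot N := value (triS (supp T) (@factor1 R F T) (@factor2 R F T) (@factor3 R F T))
  (triv v (@factor1 R F T) (@factor2 R F T) (@factor3 R F T)) [set: word _ _ _ N]%SET.
pose mv N c := mval (supp T) v (@factor1 R F T) (@factor2 R F T) (@factor3 R F T) N c c c.
have totE : Vpr_seq T rho = fun N => tot N `^ (3 * N)%:R^-1.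
  by apply/funext => N; rewrite /Vpr_seq VprNE.
have mvE P : VprP_seq r rho P = fun N => mv N (r N P) `^ (3 * N)%:R^-1.
  by apply/funext => N; rewrite /VprP_seq VprPNE.
have mv_le N c : mv N c <= tot N by apply: mv_le_tot.
have lim_eq (u : nat -> R) (x : R) : u @ \oo --> x -> limn u = x.
  exact: cvg_lim.
have cvg0 P s : dist T P -> s \in supp T -> v s = 0 -> 0 < P s ->
    VprP_seq r rho P @ \oo --> (0 : R).
  move=> dP Ss vs Ps; rewrite mvE; apply: powR_cvg0.
  exact: mv_eventually0 (rd P dP) Ss vs Ps.
(* If no constituent has positive value, all sequences vanish for [N > 0] and both sides are 0; a
   point mass then attains the maximum. *)
have [[s0 [S0 v0]]|no_s] := pselect (exists s, s \in supp T /\ 0 < v s); last first.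
  have v0 s : s \in supp T -> v s = 0.
    move=> Ss; have := v_ge0 s Ss; rewrite le_eqVlt => /orP[/eqP <-|vs].
      reflexivity.
    case: no_s; exists s; split; [exact: Ss | exact: vs].
  have tot0 : Vpr_seq T rho @ \oo --> (0 : R).
    rewrite totE; apply: powR_cvg0; exists 1%N => n n0.
    exact: value_eq0.
  have mv0 P : VprP_seq r rho P @ \oo --> (0 : R).
    rewrite mvE; apply: powR_cvg0; exists 1%N => n n0.
    exact: value_eq0.
  split; [exact: cvgP tot0 | by move=> P _; apply: cvgP (mv0 P) |].
  have VP P : VprP r rho P = 0 by apply: lim_eq.
  rewrite (_ : Vpr T rho = 0); last exact: lim_eq.
  split; last by move=> _ [P _ <-]; rewrite VP.
  have /finset.set0Pn[s1 S1] := T_neq0.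
  pose P : {ffun annot T -> R} := [ffun s => (s == s1)%:R].
  have PE s : P s = (s == s1)%:R by rewrite ffunE.
  exists P; last exact: VP.
  split=> [s|s Ss|].
  - by rewrite PE; case: (s == s1).
  - by rewrite PE; case: eqP Ss => [->|_ _]; [rewrite S1 | reflexivity].
  - rewrite (bigD1 s1 S1) /= PE eqxx big1 ?addr0; first reflexivity.
    by move=> s /andP[_ /negPf ns]; rewrite PE ns.
have [l [Q [tot_l Q_ge0 Q_out sum_Q [Qv Q_opt]]]] :=
  exists_optimal_distribution v_ge0 (@factor_diag R F T) (@rotX_inj R F T)
    (@rotY_inj R F T) (@rotZ_inj R F T) (@factor1_cyc R F T) (@factor2_cyc R F T)
    (@factor3_cyc R F T) S0 v0.
have [|C [C_ge0 hC vC]] := bounding_constant v_ge0 (@factor1 R F T)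
    (@factor2 R F T) (@factor3 R F T) (Q := pred1 s0).
  by move=> s /eqP->.
have [tot0 _ _] := tot_rate v_ge0 (@factor_diag R F T) S0 C_ge0 hC (vC s0 (eqxx _)).
have tot_cvg : Vpr_seq T rho @ \oo --> expR (l / 3).
  by rewrite totE; exact: powR_rate (fun n _ => tot0 n) tot_l.
have mv_cvg P : dist T P -> (forall s, 0 < P s -> 0 < v s) ->
    exists l', [/\ VprP_seq r rho P @ \oo --> expR (l' / 3), l' <= l &
      rate (fun N => ln (mv N (r N P))) l'].
  move=> dP Pv; have [P_ge0 _ _] := dP.
  have [mv0 [l' mv_l']] := mv_rate v_ge0 (@factor_diag R F T) (fun s _ => P_ge0 s)
    (rd P dP) Pv.
  exists l'; split; [by rewrite mvE; exact: powR_rate mv0 mv_l' | | exact: mv_l'].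
  apply: rate_le mv_l' tot_l; exists 1%N => n n0.
  by rewrite ler_ln ?posrE; [exact: mv_le | exact: mv0 | exact: tot0].
(* Either [P] charges a constituent of value 0, which forces the limit 0, or all charged values are
   positive and [mv_cvg] applies. *)
have cases P : dist T P -> VprP_seq r rho P @ \oo --> (0 : R) \/
    (forall s, 0 < P s -> 0 < v s).
  move=> dP; have [Pv|nPv] := pselect (forall s, 0 < P s -> 0 < v s); first by right.
  left; have [s [Ps vs]] : exists s, 0 < P s /\ ~ 0 < v s.
    apply: contrapT => no_s; apply: nPv => s Ps; apply: contrapT => vs.
    by apply: no_s; exists s; split; [exact: Ps | exact: vs].
  have [_ P_out _] := dP.
  have Ss : s \in supp T by apply: contraT => /P_out e; rewrite e ltxx in Ps.
  apply: (cvg0 P s dP Ss _ Ps); apply/eqP; rewrite eq_le (v_ge0 s Ss) andbT leNgt.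
  exact: introN idP vs.
have VE : Vpr T rho = expR (l / 3) by apply: lim_eq.
split; first exact: cvgP tot_cvg.
  move=> P dP; have [/cvgP//|Pv] := cases P dP.
  by have [l' [/cvgP]] := mv_cvg P dP Pv.
split=> [|_ [P dP <-]].
  pose P : {ffun annot T -> R} := [ffun s => Q s].
  have PE : P =1 Q by move=> s; rewrite ffunE.
  have dP : dist T P.
    split=> [s|s Ss|]; first by rewrite PE; exact: Q_ge0.
      by rewrite PE; exact: Q_out.
    by under eq_bigr do rewrite PE; exact: sum_Q.
  have Pv s : 0 < P s -> 0 < v s by rewrite PE; apply: Qv.
  have [l' [cvg_l' l'_le mv_l']] := mv_cvg P dP Pv.
  exists P; [exact: dP | rewrite VE; apply: lim_eq].
  (* [l' <= l] comes from the bound of [mv] by [tot], the converse from the optimality of [Q]. *)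
  suff -> : l = l' by exact: cvg_l'.
  apply/le_anti; rewrite l'_le andbT; apply: Q_opt mv_l'.
  by rewrite -(funext PE); apply: rd.
have [P0|Pv] := cases P dP.
  have -> : VprP r rho P = 0 by exact: lim_eq P0.
  by rewrite VE; exact: expR_ge0.
have [l' [cvg_l' l'_le _]] := mv_cvg P dP Pv.
have -> : VprP r rho P = expR (l' / 3) by exact: lim_eq cvg_l'.
by rewrite VE ler_expR ler_pM2r ?invr_gt0 ?ltr0n; [exact: l'_le | ].
Qed.
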